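(* Let $M=M_1^{a_1}\oplus\cdots\oplus M_n^{a_n}$ with $M_1,\dots,M_n$ pairwise non-isomorphic finite indecomposable $R$-modules and $a_i\ge1$, let $\mathcal C=\langle M_1,\dots,M_n\rangle$, and let $V$ be an irreducible representation of $\mathrm{Aut}_R(M)$. If $(M,V)\leadsto(F,\widetilde V)$ is the functor morphing of $(M,V)$, then $\deg(M,V)\ge\deg(F,\widetilde V)$ in the lexicographical order on $\mathbb Z_{\ge 0}^3$. If equality holds then necessarily $F\cong F_M:=\mathrm{Hom}_R(M,-)$ and $V\cong\widetilde V$ as representations of $\mathrm{Aut}_R(M)\cong\mathrm{Aut}_{\mathcal C_{+1}}(F_M)$.
   Context: Let $\mathfrak o$ be a complete discrete valuation ring with uniformiser $\pi$ and finite residue field, $\ell\ge 1$, $\mathfrak o_\ell=\mathfrak o/\pi^\ell$. $R$ is a finite (not necessarily commutative) $\mathfrak o_\ell$-algebra, modules are left modules, and $K$ is an algebraically closed field of characteristic $0$; representations are finite-dimensional over $K$. $\mathcal C=\langle M_1,\dots,M_n\rangle$ is the full subcategory of $R$-modules of the form $\bigoplus_i M_i^{b_i}$, $b_i\in\mathbb Z_{\ge0}$. $\mathcal C_{+1}$ is the (abelian, Krull–Schmidt) category of $\mathfrak o_\ell$-linear functors from $\mathcal C$ to finite $\mathfrak o_\ell$-modules. For $F\in\mathcal C_{+1}$, $KF(M)$ is the $K$-vector space with basis $\{u_m\mid m\in F(M)\}$, a permutation representation of $\mathrm{Aut}_R(M)$ via $g\cdot u_m=u_{F(g)(m)}$.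 $G\prec F$ means that $G$ is isomorphic to a subquotient of $F$ and $G\not\cong F$. $\overline{KF(M)}$ is the largest subrepresentation of $KF(M)$ with $\mathrm{Hom}_{\mathrm{Aut}_R(M)}(KG(M),\overline{KF(M)})=0$ for every $G\prec F$. Functor morphing: for each irreducible representation $V$ of $\mathrm{Aut}_R(M)$ there is a unique (up to isomorphism) $F\in\mathcal C_{+1}$ with $\mathrm{Hom}_{\mathrm{Aut}_R(M)}(KF(M),V)\ne0$ and $\mathrm{Hom}_{\mathrm{Aut}_R(M)}(KG(M),V)=0$ for all $G\prec F$. Put $\widetilde V=\mathrm{Hom}_{\mathrm{Aut}_R(M)}(\overline{KF(M)},V)$, with $\alpha\in\mathrm{Aut}_{\mathcal C_{+1}}(F)$ acting by $\alpha\cdot h=h\circ(\alpha_* )^{-1}$, where $\alpha_*(u_m)=u_{\alpha_M(m)}$; it is an irreducible representation of $\mathrm{Aut}_{\mathcal C_{+1}}(F)$. One writes $(M,V)\leadsto(F,\widetilde V)$. Degrees: $\deg(M,V)=(\dim V,|\mathrm{Aut}_R(M)|,\mathrm{Supp}(M))$, where $\mathrm{Supp}(M)$ is the number of isomorphism classes of indecomposable direct summands of $M$; $\deg(F,\widetilde V)=(\dim\widetilde V,|\mathrm{Aut}_{\mathcal C_{+1}}(F)|,\mathrm{Supp}(F))$, where $\mathrm{Supp}(F)$ is the number of isomorphism classes of indecomposable direct summands of $F$ in $\mathcal C_{+1}$. The isomorphism $\mathrm{Aut}_R(M)\cong\mathrm{Aut}_{\mathcal C_{+1}}(F_M)$ is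 the one from Yoneda's lemma, $\varphi\mapsto(\varphi^{-1})^*$ (precomposition with $\varphi^{-1}$). *)

(* Defs.v *)
From HB Require Import structures.
From mathcomp Require Import all_boot all_order all_algebra all_fingroup all_character.
From mathcomp Require Import boolp.
From mathcomp Require classical_sets.
Set Implicit Arguments.
Unset Strict Implicit.
Unset Printing Implicit Defensive.
Import GRing.Theory.
Local Open Scope ring_scope.

Section Hom.
Variables (S : finNzRingType) (A B : finLmodType S).

Definition hom_linear (f : {ffun A -> B}) : bool :=
  [forall c : S, forall x, forall y, f (c *: x + y) == c *: f x + f y].

Record hom := Hom { hom_ffun : {ffun A -> B}; _ : hom_linear hom_ffun }.
HB.instance Definition _ := [isSub for hom_ffun].
HB.instance Definition _ := [Finite of hom by <:].

Definition hom_fun (f : hom) : A -> B := hom_ffun f.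
Coercion hom_fun : hom >-> Funclass.

Lemma hom_fun_linear (f : hom) : linear (hom_fun f).
Proof.
case: f => f fl c x y; rewrite /hom_fun /=.
by move/forallP: fl => /(_ c)/forallP/(_ x)/forallP/(_ y)/eqP.
Qed.
HB.instance Definition _ (f : hom) :=
  GRing.isLinear.Build S A B *:%R (hom_fun f) (hom_fun_linear f).

Lemma hom_linear_finfun (f : A -> B) : linear f -> hom_linear [ffun x => f x].
Proof.
by move=> fl; do 3!apply/forallP=> ?; rewrite !ffunE; apply/eqP/fl.
Qed.

Definition mkhom (f : A -> B) (fl : linear f) : hom := Hom (hom_linear_finfun fl).

Lemma mkhomE (f : A -> B) (fl : linear f) x : mkhom fl x = f x.
Proof. by rewrite /hom_fun ffunE. Qed.

Lemma homP (f g : hom) : f =1 g <-> f = g.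
Proof. by split=> [fg|-> //]; apply/val_inj/ffunP. Qed.

Lemma hom_add_linear (f g : hom) : linear (fun x => f x + g x).
Proof. by move=> c x y; rewrite !linearP scalerDr addrACA. Qed.
Lemma hom_opp_linear (f : hom) : linear (fun x => - f x).
Proof. by move=> c x y; rewrite linearP opprD scalerN. Qed.
Lemma hom0_linear : linear (fun _ : A => 0 : B).
Proof. by move=> c x y; rewrite scaler0 addr0. Qed.

Definition hom_add f g := mkhom (hom_add_linear f g).
Definition hom_opp f := mkhom (hom_opp_linear f).
Definition hom0 := mkhom hom0_linear.

Lemma hom_addA : associative hom_add.
Proof. by move=> f g h; apply/homP => x; rewrite !mkhomE addrA. Qed.
Lemma hom_addC : commutative hom_add.
Proof. by move=> f g; apply/homP => x; rewrite !mkhomE addrC. Qed.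
Lemma hom_add0 : left_id hom0 hom_add.
Proof. by move=> f; apply/homP => x; rewrite !mkhomE add0r. Qed.
Lemma hom_addN : left_inverse hom0 hom_opp hom_add.
Proof. by move=> f; apply/homP => x; rewrite !mkhomE addNr. Qed.
HB.instance Definition _ :=
  GRing.isZmodule.Build hom hom_addA hom_addC hom_add0 hom_addN.

Lemma hom_addE (f g : hom) x : (f + g) x = f x + g x.
Proof. exact: mkhomE. Qed.
Lemma hom_0E x : (0 : hom) x = 0.
Proof. exact: mkhomE. Qed.

End Hom.

Lemma hom_id_linear (S : finNzRingType) (A : finLmodType S) : linear (@id A).
Proof. by []. Qed.
Definition idhom (S : finNzRingType) (A : finLmodType S) : hom A A :=
  mkhom (@hom_id_linear S A).

Lemma comp_linear (S : finNzRingType) (A B C : finLmodType S)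
  (g : hom B C) (f : hom A B) : linear (g \o f).
Proof. by move=> c x y; rewrite /= !linearP. Qed.
Definition comphom (S : finNzRingType) (A B C : finLmodType S)
  (g : hom B C) (f : hom A B) : hom A C := mkhom (comp_linear g f).

(* An [R]-module is an [ol]-module through [c |-> c%:A], which makes *)
(* [hom A B] an [ol]-module.                                         *)
Section HomAlgebra.
Variables (ol : finComNzRingType) (R : finAlgType ol) (A B : finLmodType R).

Lemma hom_scale_linear (c : ol) (f : hom A B) :
  linear (fun x => (c%:A : R) *: f x).
Proof.
move=> r x y; rewrite linearP scalerDr !scalerA; congr (_ *: _ + _).
by rewrite -scalerAl -scalerAr mul1r mulr1.
Qed.
Definition hom_scale c f := mkhom (hom_scale_linear c f).

Lemma hom_scaleA c d f : hom_scale c (hom_scale d f) = hom_scale (c * d) f.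
Proof.
by apply/homP => x; rewrite !mkhomE scalerA -scalerAl mul1r scalerA.
Qed.
Lemma hom_scale1 : left_id 1 hom_scale.
Proof. by move=> f; apply/homP => x; rewrite !mkhomE !scale1r. Qed.
Lemma hom_scaleDr : right_distributive hom_scale +%R.
Proof. by move=> c f g; apply/homP => x; rewrite !mkhomE scalerDr. Qed.
Lemma hom_scaleDl f : {morph hom_scale^~ f : c d / c + d}.
Proof. by move=> c d; apply/homP => x; rewrite !mkhomE !scalerDl. Qed.
HB.instance Definition _ := GRing.Zmodule_isLmodule.Build ol (hom A B)
  hom_scaleA hom_scale1 hom_scaleDr hom_scaleDl.

Lemma hom_scaleE (c : ol) (f : hom A B) x : (c *: f) x = (c%:A : R) *: f x.
Proof. exact: mkhomE. Qed.

End HomAlgebra.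

Section Modules.
Variable S : finNzRingType.
Implicit Types A B N : finLmodType S.

Definition mod_iso A B : Prop := exists f : hom A B, bijective f.

Definition mod_dsum N A B : Prop :=
  exists f : {linear (A * B)%type -> N}, bijective f.

Definition mod_zero A : Prop := forall x : A, x = 0.

Definition mod_indec N : Prop :=
  ~ mod_zero N /\ forall A B, mod_dsum N A B -> mod_zero A \/ mod_zero B.

Definition autR_set A : {set {perm A}} :=
  [set s : {perm A} | hom_linear [ffun x => s x]].

Lemma autR_setP A (s : {perm A}) : s \in autR_set A <-> linear s.
Proof.
rewrite inE; split=> [sl c x y|/hom_linear_finfun //].
by have := hom_fun_linear (Hom sl) c x y; rewrite /hom_fun /= !ffunE.
Qed.

Lemma autR_group_set A : group_set (autR_set A).
Proof.
apply/group_setP; split; first by apply/autR_setP => c x y; rewrite !perm1.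
move=> s t /autR_setP sl /autR_setP tl; apply/autR_setP => c x y.
by rewrite !permM sl tl.
Qed.
Canonical autR_group A := Group (autR_group_set A).

(* The group of automorphisms of [A].  As everywhere in the library, products *)
(* of permutations are read from left to right, [(s * t) x = t (s x)], and    *)
(* groups act on row vectors from the right, so that a left representation    *)
(* in the classical sense (product = composition of maps) is exactly an       *)
(* [mx_representation].                                                       *)
Definition autR A := subg_of (autR_group A).
HB.instance Definition _ A := FinGroup.on (autR A).

Lemma autR_linear A (s : autR A) : linear (sgval s).
Proof. exact/autR_setP/subgP. Qed.
Definition autR_hom A (s : autR A) : hom A A := mkhom (autR_linear s).

Lemma autR_hom1 A : autR_hom (1%g : autR A) = idhom A.
Proof. by apply/homP => x; rewrite !mkhomE perm1. Qed.
Lemma autR_homM A (s t : autR A) :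
  autR_hom (s * t)%g = comphom (autR_hom t) (autR_hom s).
Proof. by apply/homP => x; rewrite !mkhomE /= !mkhomE permM. Qed.

End Modules.

Section DirectSum.
Variables (S : finNzRingType) (n : nat) (M : 'I_n -> finLmodType S).
Variable b : 'I_n -> nat.

Definition dsum := {dffun forall k : {i : 'I_n & 'I_(b i)}, M (tag k)}.
HB.instance Definition _ := Finite.on dsum.
Implicit Types x y : dsum.

Definition dsum_add x y : dsum := [ffun k => x k + y k].
Definition dsum_opp x : dsum := [ffun k => - x k].
Definition dsum0 : dsum := [ffun k => 0].
Definition dsum_scale (c : S) x : dsum := [ffun k => c *: x k].

Lemma dsum_addA : associative dsum_add.
Proof. by move=> x y z; apply/ffunP => k; rewrite !ffunE addrA. Qed.
Lemma dsum_addC : commutative dsum_add.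
Proof. by move=> x y; apply/ffunP => k; rewrite !ffunE addrC. Qed.
Lemma dsum_add0 : left_id dsum0 dsum_add.
Proof. by move=> x; apply/ffunP => k; rewrite !ffunE add0r. Qed.
Lemma dsum_addN : left_inverse dsum0 dsum_opp dsum_add.
Proof. by move=> x; apply/ffunP => k; rewrite !ffunE addNr. Qed.
HB.instance Definition _ :=
  GRing.isZmodule.Build dsum dsum_addA dsum_addC dsum_add0 dsum_addN.

Lemma dsum_scaleA c d x : dsum_scale c (dsum_scale d x) = dsum_scale (c * d) x.
Proof. by apply/ffunP => k; rewrite !ffunE scalerA. Qed.
Lemma dsum_scale1 : left_id 1 dsum_scale.
Proof. by move=> x; apply/ffunP => k; rewrite !ffunE scale1r. Qed.
Lemma dsum_scaleDr : right_distributive dsum_scale +%R.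
Proof. by move=> c x y; apply/ffunP => k; rewrite !ffunE scalerDr. Qed.
Lemma dsum_scaleDl x : {morph dsum_scale^~ x : c d / c + d}.
Proof. by move=> c d; apply/ffunP => k; rewrite !ffunE scalerDl. Qed.
HB.instance Definition _ := GRing.Zmodule_isLmodule.Build S dsum
  dsum_scaleA dsum_scale1 dsum_scaleDr dsum_scaleDl.

Lemma dsum_addE x y k : (x + y) k = x k + y k.
Proof. by rewrite ffunE. Qed.
Lemma dsum_0E k : (0 : dsum) k = 0.
Proof. by rewrite ffunE. Qed.
Lemma dsum_scaleE c x k : (c *: x) k = c *: x k.
Proof. by rewrite ffunE. Qed.
Lemma dsum_sumE (I : Type) (r : seq I) (f : I -> dsum) k :
  (\sum_(j <- r) f j) k = \sum_(j <- r) f j k.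
Proof. by apply: (big_morph (fun x : dsum => x k)) => [x y|]; rewrite ffunE. Qed.
End DirectSum.

(* The full subcategory [C] of sums of the [M i] has the multiplicity vectors *)
(* [b : 'I_n -> nat] as objects, with [hom (dsum M b) (dsum M c)] as the      *)
(* morphisms from [b] to [c].                                                 *)
Section FunctorCategory.
Variables (ol : finComNzRingType) (R : finAlgType ol).
Variables (n : nat) (M : 'I_n -> finLmodType R).
Local Notation obj := ('I_n -> nat).
Local Notation X b := (dsum M b : finLmodType R).

Record functor := Functor {
  fobj :> obj -> finLmodType ol;
  fmap : forall b c : obj, hom (X b) (X c) -> hom (fobj b) (fobj c);
  fmap_id : forall b, fmap (idhom (X b)) = idhom (fobj b);
  fmap_comp : forall b c d (g : hom (X c) (X d)) (f : hom (X b) (X c)),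
    fmap (comphom g f) = comphom (fmap g) (fmap f);
  fmap_linear : forall b c (k : ol) (f g : hom (X b) (X c)) (x : fobj b),
    fmap (k *: f + g) x = k *: fmap f x + fmap g x }.
Arguments fmap F {b c} : rename.

Record nat_trans (F G : functor) := NatTrans {
  nt_hom :> forall b : obj, hom (F b) (G b);
  nt_natural : forall b c (f : hom (X b) (X c)) (x : F b),
    nt_hom c (fmap F f x) = fmap G f (nt_hom b x) }.

Record nat_iso (F G : functor) := NatIso {
  ni_trans :> nat_trans F G;
  ni_bij : forall b, bijective (ni_trans b) }.

Implicit Types F G H : functor.

Lemma nat_isoP F G (s t : nat_iso F G) : (forall b, s b =1 t b) -> s = t.
Proof.
case: s t => [[s sn] sb] [[t tn] tb] /= st.
have e : s = t by apply: functional_extensionality_dep => b; apply/homP/st.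
subst t; rewrite (Prop_irrelevance sn tn) in sb *.
by rewrite (Prop_irrelevance sb tb).
Qed.

Lemma ni_id_natural F : forall b c (f : hom (X b) (X c)) (x : F b),
  idhom (F c) (fmap F f x) = fmap F f (idhom (F b) x).
Proof. by move=> *; rewrite !mkhomE. Qed.
Lemma ni_id_bij F b : bijective (idhom (F b)).
Proof. by exists id => x; rewrite !mkhomE. Qed.
Definition ni_id F : nat_iso F F :=
  @NatIso F F (NatTrans (@ni_id_natural F)) (@ni_id_bij F).

(* [ni_comp s t] is [s] followed by [t]. *)
Section Comp.
Variables (F G H : functor) (s : nat_iso F G) (t : nat_iso G H).
Lemma ni_comp_natural : forall b c (f : hom (X b) (X c)) (x : F b),
  comphom (t c) (s c) (fmap F f x) = fmap H f (comphom (t b) (s b) x).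
Proof. by move=> *; rewrite !mkhomE /= !nt_natural. Qed.
Lemma ni_comp_bij b : bijective (comphom (t b) (s b)).
Proof.
apply: (eq_bij (bij_comp (ni_bij t b) (ni_bij s b))) => x.
by rewrite mkhomE.
Qed.
Definition ni_comp : nat_iso F H :=
  @NatIso F H (NatTrans ni_comp_natural) ni_comp_bij.
Lemma ni_compE b x : ni_comp b x = t b (s b x).
Proof. exact: mkhomE. Qed.
End Comp.

Section Inverse.
Variables (F G : functor) (s : nat_iso F G).
Definition ni_inv_fun b (y : G b) : F b := odflt 0 [pick x | s b x == y].
Lemma ni_invKV b : cancel (@ni_inv_fun b) (s b).
Proof.
move=> y; rewrite /ni_inv_fun; case: pickP => [x /eqP //|].
have [g _ gK] := ni_bij s b.
by move=> /(_ (g y)); rewrite gK eqxx.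
Qed.
Lemma ni_invK b : cancel (s b) (@ni_inv_fun b).
Proof. by move=> x; apply: (bij_inj (ni_bij s b)); rewrite ni_invKV. Qed.
Lemma ni_inv_linear b : linear (@ni_inv_fun b).
Proof.
by move=> c x y; apply: (bij_inj (ni_bij s b)); rewrite linearP /= !ni_invKV.
Qed.
Lemma ni_inv_natural : forall b c (f : hom (X b) (X c)) (y : G b),
  mkhom (@ni_inv_linear c) (fmap G f y) = fmap F f (mkhom (@ni_inv_linear b) y).
Proof.
move=> b c f y; rewrite !mkhomE; apply: (bij_inj (ni_bij s c)).
by rewrite nt_natural !ni_invKV.
Qed.
Lemma ni_inv_bij b : bijective (mkhom (@ni_inv_linear b)).
Proof. by exists (s b) => x; rewrite mkhomE ?ni_invK ?ni_invKV. Qed.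
Definition ni_inv : nat_iso G F :=
  @NatIso G F (NatTrans ni_inv_natural) ni_inv_bij.
Lemma ni_invE b y : ni_inv b y = ni_inv_fun y.
Proof. exact: mkhomE. Qed.
End Inverse.

(* Natural isomorphisms are determined by their component at the object       *)
(* [\bigoplus_i M i]; hence they form a finite type.                          *)
Section Finiteness.
Let u : obj := fun=> 1%N.

Definition to_summand (b : obj) (k : {i : 'I_n & 'I_(b i)}) (x : X b) : X u :=
  [ffun k' : {i : 'I_n & 'I_(u i)} => dfwith (fun i => 0 : M i) (x k) (tag k')].
Definition of_summand (b : obj) (k : {i : 'I_n & 'I_(b i)}) (y : X u) : X b :=
  [ffun k' => @dfwith {i : 'I_n & 'I_(b i)} (fun k'' => M (tag k'')) (fun=> 0) k
     (y (Tagged (fun i => 'I_(u i)) (ord0 : 'I_(u (tag k))))) k'].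

Lemma dfwith_linear (I : eqType) (T : I -> finLmodType R) (i j : I) :
  linear (fun x : T i => dfwith (fun j => 0 : T j) x j).
Proof.
move=> c x y; case: (eqVneq i j) => [<-|ij]; first by rewrite !dfwith_in.
by rewrite !dfwith_out // scaler0 addr0.
Qed.
Lemma to_summand_linear b (k : {i : 'I_n & 'I_(b i)}) : linear (to_summand k).
Proof.
move=> c x y; apply/ffunP => k'; rewrite dsum_addE dsum_scaleE !ffunE.
exact: (dfwith_linear (T := M)).
Qed.
Lemma of_summand_linear b (k : {i : 'I_n & 'I_(b i)}) : linear (of_summand k).
Proof.
move=> c x y; apply/ffunP => k'; rewrite dsum_addE dsum_scaleE !ffunE.
by rewrite (dfwith_linear (T := fun k : {i : 'I_n & 'I_(b i)} => M (tag k))).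
Qed.

Lemma summand_sum b :
  \sum_(k : {i : 'I_n & 'I_(b i)})
     comphom (mkhom (of_summand_linear k)) (mkhom (to_summand_linear k))
  = idhom (X b).
Proof.
apply/homP => x; rewrite mkhomE; apply/ffunP => k.
rewrite (big_morph (fun f : hom (X b) (X b) => f x)
  (fun f g => hom_addE f g x) (hom_0E _ x)).
rewrite dsum_sumE (bigD1 k) //= big1 => [|j jk].
  by rewrite addr0 mkhomE /= !mkhomE !ffunE dfwith_in dfwith_in.
by rewrite mkhomE /= !mkhomE !ffunE dfwith_out.
Qed.

Lemma fmap_sum (F : functor) b c (I : Type) (r : seq I)
    (f : I -> hom (X b) (X c)) x :
  fmap F (\sum_(i <- r) f i) x = \sum_(i <- r) fmap F (f i) x.
Proof.
have fD g h : fmap F (g + h) x = fmap F g x + fmap F h x.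
  by have := fmap_linear 1 g h x; rewrite !scale1r.
apply: (big_morph (fun g : hom (X b) (X c) => fmap F g x)) => //.
by apply: (@addrI _ (fmap F 0 x)); rewrite -fD !addr0.
Qed.

Variables F G : functor.

Definition ni_code (s : nat_iso F G) : hom (F u) (G u) := s u.

Lemma ni_code_inj : injective ni_code.
Proof.
move=> s t st; apply: nat_isoP => b x.
have -> : x = \sum_(k : {i : 'I_n & 'I_(b i)})
   fmap F (mkhom (of_summand_linear k))
     (fmap F (mkhom (to_summand_linear k)) x).
  have := fmap_sum (F := F) (index_enum _)
    (fun k => comphom (mkhom (of_summand_linear k))
                      (mkhom (to_summand_linear k))) x.
  rewrite summand_sum fmap_id mkhomE => e; rewrite [LHS]e; apply: eq_bigr => k _.
  by rewrite fmap_comp mkhomE.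
rewrite !linear_sum /=; apply: eq_bigr => k _.
rewrite !(nt_natural _ (mkhom (of_summand_linear k))).
by congr (fmap G _ _); rewrite -[LHS]/(ni_code s _) st.
Qed.

Definition ni_decode (f : hom (F u) (G u)) : option (nat_iso F G) :=
  if pselect (exists s, ni_code s = f) is left h then Some (projT1 (cid h))
  else None.
Lemma ni_codeK : pcancel ni_code ni_decode.
Proof.
move=> s; rewrite /ni_decode; case: pselect => [h|[]]; last by exists s.
by congr Some; apply: ni_code_inj; case: cid.
Qed.
HB.instance Definition _ := Finite.copy (nat_iso F G) (pcan_type ni_codeK).
End Finiteness.

(* The automorphism group of [F]; as for permutations, [s * t] is [s] *)
(* followed by [t].                                                   *)
Definition autF (F : functor) : Type := nat_iso F F.
HB.instance Definition _ F := Finite.on (autF F).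

Section AutF.
Variable F : functor.
Definition autF_mul (s t : autF F) : autF F := ni_comp s t.
Definition autF_one : autF F := ni_id F.
Definition autF_inv (s : autF F) : autF F := ni_inv s.
Lemma autF_mulA : associative autF_mul.
Proof. by move=> r s t; apply: nat_isoP => b x; rewrite !ni_compE. Qed.
Lemma autF_mul1 : left_id autF_one autF_mul.
Proof. by move=> s; apply: nat_isoP => b x; rewrite !ni_compE mkhomE. Qed.
Lemma autF_mulV : left_inverse autF_one autF_inv autF_mul.
Proof.
by move=> s; apply: nat_isoP => b x; rewrite ni_compE ni_invE ni_invKV mkhomE.
Qed.
HB.instance Definition _ := Finite_isGroup.Build (autF F)
  autF_mulA autF_mul1 autF_mulV.
End AutF.

Definition functor_iso F G : Prop := inhabited (nat_iso F G).
Definition functor_zero (F : functor) : Prop := forall b (x : F b), x = 0.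

(* Direct sums of functors are objectwise; the decomposition of [F] is given *)
(* by the two coprojections [s] and [t].                                     *)
Definition functor_dsum (F A B : functor) : Prop :=
  exists (s : nat_trans A F) (t : nat_trans B F),
    forall b, bijective (fun z : A b * B b => s b z.1 + t b z.2).

Definition functor_indec F : Prop :=
  ~ functor_zero F /\
  forall A B, functor_dsum F A B -> functor_zero A \/ functor_zero B.

(* Monomorphisms and epimorphisms of functors are computed objectwise. *)
Definition subquotient G F : Prop :=
  exists H (i : nat_trans H F) (p : nat_trans H G),
    (forall b, injective (i b)) /\
    (forall b (y : G b), exists x, p b x = y).

Definition prec G F : Prop := subquotient G F /\ ~ functor_iso G F.

Section Yoneda.
Variable a : obj.

Definition post_fun b c (f : hom (X b) (X c)) (g : hom (X a) (X b)) :
  hom (X a) (X c) := comphom f g.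
Lemma post_linear b c (f : hom (X b) (X c)) : linear (post_fun f).
Proof.
move=> k g h; apply/homP => x.
by rewrite mkhomE /= !hom_addE !hom_scaleE mkhomE linearP mkhomE.
Qed.
Lemma yon_id b : mkhom (post_linear (idhom (X b))) = idhom (hom (X a) (X b)).
Proof. by apply/homP => g; apply/homP => x; rewrite !mkhomE /= mkhomE. Qed.
Lemma yon_comp b c d (g : hom (X c) (X d)) (f : hom (X b) (X c)) :
  mkhom (post_linear (comphom g f))
  = comphom (mkhom (post_linear g)) (mkhom (post_linear f)).
Proof.
by apply/homP => h; apply/homP => x; rewrite !mkhomE /= !mkhomE /= !mkhomE.
Qed.
Lemma yon_linear b c (k : ol) (f g : hom (X b) (X c)) (h : hom (X a) (X b)) :
  mkhom (post_linear (k *: f + g)) h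
  = k *: mkhom (post_linear f) h + mkhom (post_linear g) h.
Proof.
by apply/homP => x; do 3 rewrite ?(mkhomE, hom_addE, hom_scaleE) /=.
Qed.

(* The functor [Hom_R(X a, -)]. *)
Definition yon : functor :=
  @Functor (fun b => hom (X a) (X b)) (fun b c f => mkhom (post_linear f))
    yon_id yon_comp yon_linear.

Section YonAut.
Variable s : autR (X a).
Definition pre_fun b (g : hom (X a) (X b)) : hom (X a) (X b) :=
  comphom g (autR_hom s^-1%g).
Lemma pre_linear b : linear (@pre_fun b).
Proof.
move=> k g h; apply/homP => x.
by do 3 rewrite ?(mkhomE, hom_addE, hom_scaleE) /=.
Qed.
Lemma pre_natural b c (f : hom (X b) (X c)) (g : yon b) :
  mkhom (@pre_linear c) (fmap yon f g) = fmap yon f (mkhom (@pre_linear b) g).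
Proof. by apply/homP => x; rewrite !mkhomE /= !mkhomE /= !mkhomE. Qed.
Lemma pre_bij b : bijective (mkhom (@pre_linear b)).
Proof.
exists (fun g => comphom g (autR_hom s)) => g; apply/homP => x;
  by rewrite !mkhomE /= !mkhomE /= !mkhomE /= ?permK ?permKV.
Qed.
Definition yon_aut : autF yon := 
  @NatIso yon yon (@NatTrans yon yon (fun b => mkhom (@pre_linear b)) pre_natural)
    pre_bij.
Lemma yon_autE b g x : yon_aut b g x = g ((sgval s)^-1%g x).
Proof. by rewrite !mkhomE /= mkhomE. Qed.
End YonAut.

Lemma yon_autM : {morph yon_aut : s t / (s * t)%g}.
Proof.
move=> s t; apply: nat_isoP => b g; apply/homP => x.
by rewrite ni_compE !yon_autE invMg permM.
Qed.
End Yoneda.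

Definition conj_aut F G (e : nat_iso F G) (s : autF G) : autF F :=
  ni_comp (ni_comp e s) (ni_inv e).
Lemma conj_autM F G (e : nat_iso F G) : {morph conj_aut e : s t / (s * t)%g}.
Proof.
move=> s t; apply: nat_isoP => b x.
by rewrite !(ni_compE, ni_invE) ni_invKV.
Qed.

End FunctorCategory.
Arguments fmap {ol R n M} F {b c} : rename.

Section Representations.
Variable K : fieldType.

Section Intertwiners.
Variables (gT : finGroupType) (G : {group gT}) (n1 n2 : nat).
Variables (rG1 : mx_representation K G n1) (rG2 : mx_representation K G n2).

(* The row space of [hom_mx] is the space [Hom_G(rG1, rG2)], each map being *)
(* flattened by [mxvec].                                                    *)
Definition hom_mx : 'M[K]_(n1 * n2) :=
  (\bigcap_(g in G) kermx (lin_mulmx (rG1 g) - lin_mulmxr (rG2 g)))%MS.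

Lemma hom_mxP (h : 'M_(n1, n2)) :
  (mxvec h <= hom_mx)%MS <-> {in G, forall g, rG1 g *m h = h *m rG2 g}.
Proof.
have E g : (mxvec h <= kermx (lin_mulmx (rG1 g) - lin_mulmxr (rG2 g)))%MS
    = (rG1 g *m h == h *m rG2 g).
  rewrite sub_kermx mulmxBr !mul_vec_lin /= -linearB mxvec_eq0 subr_eq0.
  by [].
split=> [/sub_bigcapmxP hG g Gg|hG]; first by apply/eqP; rewrite -E hG.
by apply/sub_bigcapmxP => g Gg; rewrite E hG.
Qed.

Lemma hom_mx0P : hom_mx = 0 <->
  (forall h : 'M_(n1, n2), {in G, forall g, rG1 g *m h = h *m rG2 g} -> h = 0).
Proof.
split=> [h0 h /hom_mxP|H].
  by rewrite h0 submx0 mxvec_eq0 => /eqP.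
apply/row_matrixP => i; rewrite row0 -[row i _]vec_mxK.
by rewrite [vec_mx _]H ?linear0 //; apply/hom_mxP; rewrite vec_mxK row_sub.
Qed.
End Intertwiners.

Section PermutationRepresentation.
Variables (gT : finGroupType) (T : finType) (to : {action gT &-> T}).

(* The basis vector [u_x] is [delta_mx 0 (enum_rank x)]. *)
Definition act_mx (g : gT) : 'M[K]_#|T| :=
  \matrix_i delta_mx 0 (enum_rank (to (enum_val i) g)).

Lemma act_mxE x g : (delta_mx 0 (enum_rank x) : 'rV_#|T|) *m act_mx g
  = delta_mx 0 (enum_rank (to x g)).
Proof. by rewrite -rowE rowK enum_rankK. Qed.

Lemma act_mx_repr : mx_repr [set: gT] act_mx.
Proof.
split=> [|g h _ _]; apply/row_matrixP => i; rewrite !rowE -(enum_valK i).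
  by rewrite act_mxE act1 mulmx1.
by rewrite mulmxA !act_mxE actM.
Qed.
Definition act_repr := MxRepresentation act_mx_repr.
End PermutationRepresentation.

Section Precomposition.
Variables (gT : finGroupType) (n1 n2 : nat).
Variable rG : mx_representation K [set: gT] n1.

(* [g] sends [h] to [h \o g^-1]: on rows, first [rG g^-1] and then [h]. *)
Definition precomp_mx (g : gT) : 'M[K]_(n1 * n2) := lin_mulmx (rG g^-1%g).

Lemma precomp_mx_repr : mx_repr [set: gT] precomp_mx.
Proof.
split=> [|g h _ _]; rewrite /precomp_mx.
  apply/row_matrixP => i; rewrite !rowE -[delta_mx 0 i]vec_mxK mul_vec_lin /=.
  by rewrite invg1 repr_mx1 mul1mx mulmx1.
apply/row_matrixP => i; rewrite !rowE -[delta_mx 0 i]vec_mxK mulmxA.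
by rewrite !mul_vec_lin /= invMg repr_mxM ?inE // mulmxA.
Qed.
Definition precomp_repr := MxRepresentation precomp_mx_repr.
End Precomposition.

Section Pullback.
Variables (gT hT : finGroupType) (f : gT -> hT) (fM : {morph f : x y / (x * y)%g}).
Variables (d : nat) (rH : mx_representation K [set: hT] d).
Lemma pullback_mx_repr : mx_repr [set: gT] (fun g => rH (f g)).
Proof.
have f1 : f 1%g = 1%g by apply: (@mulgI _ (f 1%g)); rewrite -fM !mulg1.
by split=> [|g h _ _]; rewrite ?f1 ?repr_mx1 // fM repr_mxM ?inE.
Qed.
Definition pullback_repr := MxRepresentation pullback_mx_repr.
End Pullback.

End Representations.

Section FunctorMorphing.
Variables (K : fieldType) (ol : finComNzRingType) (R : finAlgType ol).
Variables (n : nat) (M : 'I_n -> finLmodType R) (a : 'I_n -> nat).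
Implicit Types F G : functor M.
Local Notation Xa := (dsum M a : finLmodType R).

Definition autR_act F (x : F a) (s : autR Xa) : F a := fmap F (autR_hom s) x.
Lemma autR_act1 F x : @autR_act F x 1%g = x.
Proof. by rewrite /autR_act autR_hom1 fmap_id mkhomE. Qed.
Lemma autR_actM F x : act_morph (@autR_act F) x.
Proof. by move=> s t; rewrite /autR_act autR_homM fmap_comp mkhomE. Qed.

(* [K F(M)], as a representation of [Aut_R(M)]. *)
Definition KF F : mx_representation K [set: autR Xa] #|F a| :=
  act_repr K (TotalAction (@autR_act1 F) (@autR_actM F)).

Definition autF_act F (x : F a) (s : autF F) : F a := s a x.
Lemma autF_act1 F x : @autF_act F x 1%g = x.
Proof. exact: mkhomE. Qed.
Lemma autF_actM F x : act_morph (@autF_act F) x.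
Proof. by move=> s t; apply: ni_compE. Qed.

(* The action of [Aut(F)] on [K F(M)] by the maps [alpha_*]. *)
Definition KF_autF F : mx_representation K [set: autF F] #|F a| :=
  act_repr K (TotalAction (@autF_act1 F) (@autF_actM F)).

Lemma KF_comm F s (t : autF F) : KF F s *m KF_autF F t = KF_autF F t *m KF F s.
Proof.
apply/row_matrixP => i; rewrite !rowE -(enum_valK i) !mulmxA !act_mxE /=.
by rewrite /autF_act /autR_act nt_natural.
Qed.

(* [U] is a subrepresentation of [K F(M)] with [Hom(K G(M), U) = 0] for all *)
(* [G] strictly below [F].                                                  *)
Definition hom_free F (U : 'M[K]_#|F a|) : Prop :=
  exists modU : mxmodule (KF F) U,
    forall G, prec G F -> hom_mx (KF G) (submod_repr modU) = 0.

Definition KFbar F (U : 'M[K]_#|F a|) : Prop :=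
  hom_free U /\ forall W, hom_free W -> (W <= U)%MS.

Lemma hom_freeP F (U : 'M[K]_#|F a|) : hom_free U <->
  mxmodule (KF F) U /\ forall G, prec G F -> forall h : 'M_(#|G a|, #|F a|),
    (forall s, KF G s *m h = h *m KF F s) -> (h <= U)%MS -> h = 0.
Proof.
split=> [[mU H]|[mU H]].
  split=> // G GF h hC hU; move/hom_mx0P: (H G GF) => /(_ (in_submod U h)) h0.
  rewrite -(in_submodK hU) h0 ?linear0 // => s _.
  by rewrite -in_submodJ // -hC /in_submod mulmxA.
exists mU => G GF; apply/hom_mx0P => h hC.
rewrite -[h]val_submodK (H G GF (val_submod h)) ?linear0 ?val_submodP // => s.
rewrite -(val_submodJ mU) ?inE //; have /= <- := hC s (in_setT s).
by rewrite /val_submod mulmxA.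
Qed.

Lemma KFbar_module F (U : 'M[K]_#|F a|) : KFbar U -> mxmodule (KF F) U.
Proof. by case=> [[]]. Qed.

Lemma KFbar_autF_module F (U : 'M[K]_#|F a|) :
  KFbar U -> mxmodule (KF_autF F) U.
Proof.
move=> [/hom_freeP[mU H] maxU]; apply/mxmoduleP => t _; apply: maxU.
have tV : KF_autF F t^-1%g *m KF_autF F t = 1%:M.
  by rewrite -repr_mxM ?inE // mulVg repr_mx1.
have tK : KF_autF F t *m KF_autF F t^-1%g = 1%:M.
  by rewrite -repr_mxM ?inE // mulgV repr_mx1.
apply/hom_freeP; split=> [|G GF h hC hU].
  apply/mxmoduleP => s Gs; rewrite -mulmxA -KF_comm mulmxA submxMr //.
  exact: (mxmoduleP mU).
have: h *m KF_autF F t^-1%g = 0.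
  apply: (H G GF) => [s|]; first by rewrite mulmxA hC -!mulmxA KF_comm.
  by rewrite (submx_trans (submxMr _ hU)) // -mulmxA tK mulmx1.
by move/(congr1 (mulmx^~ (KF_autF F t))); rewrite -mulmxA tV mulmx1 mul0mx.
Qed.

Section Tilde.
Variables (F : functor M) (U : 'M[K]_#|F a|) (barU : KFbar U).
Variables (d : nat) (V : mx_representation K [set: autR Xa] d).
Let rU := submod_repr (KFbar_module barU).
Let sU := submod_repr (KFbar_autF_module barU).

Lemma hom_precomp_module : mxmodule (precomp_repr d sU) (hom_mx rU V).
Proof.
apply/mxmoduleP => t _; apply/row_subP => i; rewrite row_mul.
rewrite -[row i _]vec_mxK mul_vec_lin /=; apply/hom_mxP => s Gs.
have /hom_mxP hC: (mxvec (vec_mx (row i (hom_mx rU V))) <= hom_mx rU V)%MS.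
  by rewrite vec_mxK row_sub.
have C : submod_mx (KFbar_module barU) s *m submod_mx (KFbar_autF_module barU) t^-1%g
    = submod_mx (KFbar_autF_module barU) t^-1%g *m submod_mx (KFbar_module barU) s.
  apply: (can_inj (@val_submodK _ _ U _)); rewrite !val_submodJ ?inE //.
  rewrite -[submod_mx (KFbar_module _) _]mul1mx.
  rewrite -[submod_mx (KFbar_autF_module _) _]mul1mx !val_submodJ ?inE //.
  by rewrite -!mulmxA KF_comm.
by rewrite -[RHS]mulmxA -hC // [LHS]mulmxA [RHS]mulmxA; congr (_ *m _).
Qed.

(* [Hom_{Aut_R(M)}(U, V)], as a representation of [Aut(F)]. *)
Definition tilde_repr := submod_repr hom_precomp_module.
End Tilde.

(* [(M, V)] is sent to [(F, Vt)] by functor morphing. *)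
Definition functor_morphing d (V : mx_representation K [set: autR Xa] d)
    F e (Vt : mx_representation K [set: autF F] e) : Prop :=
  [/\ hom_mx (KF F) V != 0,
      forall G, prec G F -> hom_mx (KF G) V = 0
    & exists U (barU : @KFbar F U), mx_rsim Vt (tilde_repr barU V)].

End FunctorMorphing.

Section BaseRing.
Variables (o : idomainType) (pi : o).

Definition divides (d x : o) : Prop := exists y, x = d * y.

Definition ideal (I : o -> Prop) : Prop :=
  [/\ I 0, forall x y, I x -> I y -> I (x + y) & forall c x, I x -> I (c * x)].

(* A local principal ideal domain that is not a field, and whose maximal *)
(* ideal is generated by [pi].                                           *)
Definition dvr_with_uniformiser : Prop :=
  [/\ forall I, ideal I -> exists d, forall x, I x <-> divides d x,
      forall x, x \isn't a GRing.unit <-> divides pi x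
    & pi != 0].

Definition adically_complete : Prop :=
  forall u : nat -> o,
    (forall k, exists N, forall i j, (N <= i)%N -> (N <= j)%N ->
       divides (pi ^+ k) (u i - u j)) ->
    exists x, forall k, exists N, forall i, (N <= i)%N ->
      divides (pi ^+ k) (u i - x).

(* [q] identifies [Q] with the quotient of [o] by the ideal generated by [c]. *)
Definition quotient_map (c : o) (Q : nzRingType) (q : {rmorphism o -> Q}) : Prop :=
  (forall y, exists x, q x = y) /\ (forall x, q x = 0 <-> divides c x).

Definition finite_residue_field : Prop :=
  exists (k : finFieldType) (r : {rmorphism o -> k}), quotient_map pi r.

End BaseRing.

Section Degrees.

Definition num_classes (T : Type) (P : T -> Prop) (E : T -> T -> Prop) (k : nat)
    : Prop :=
  exists N : 'I_k -> T,
    [/\ forall i, P (N i),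
        forall i j, E (N i) (N j) -> i = j
      & forall X, P X -> exists i, E X (N i)].

(* The number of classes modulo [E] of the objects satisfying [P].  The value *)
(* is 0 when there are infinitely many; this does not occur below, by the     *)
(* Krull-Schmidt theorem.                                                     *)
Definition class_count (T : Type) (P : T -> Prop) (E : T -> T -> Prop) : nat :=
  classical_sets.xget 0%N (num_classes P E).

Definition suppM (S : finNzRingType) (N : finLmodType S) : nat :=
  class_count (fun A => mod_indec A /\ exists B, mod_dsum N A B) (@mod_iso S).

(* Triples of natural numbers, with the lexicographic order. *)
Definition degree := (nat *l (nat *l nat))%type.

Variables (K : fieldType) (ol : finComNzRingType) (R : finAlgType ol).
Variables (n : nat) (M : 'I_n -> finLmodType R) (a : 'I_n -> nat).

Definition suppF (F : functor M) : nat :=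
  class_count (fun A => functor_indec A /\ exists B, functor_dsum F A B)
    (@functor_iso ol R n M).

Definition degM d (V : mx_representation K [set: autR (dsum M a)] d) : degree :=
  (d, (#|[set: autR (dsum M a)]|, suppM (dsum M a))).

Definition degF (F : functor M) e (Vt : mx_representation K [set: autF F] e)
    : degree :=
  (e, (#|[set: autF F]|, suppF F)).

(* The Yoneda isomorphism onto [Aut(F_M)], followed by the transport to *)
(* [Aut(F)] along an isomorphism from [F] to [F_M].                     *)
Definition yon_transport F (f : nat_iso F (yon M a)) (s : autR (dsum M a))
    : autF F :=
  conj_aut f (yon_aut s).

Lemma yon_transportM F (f : nat_iso F (yon M a)) :
  {morph yon_transport f : s t / (s * t)%g}.
Proof. by move=> s t; rewrite /yon_transport yon_autM conj_autM. Qed.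

End Degrees.

(* Main.v *)
From HB Require Import structures.
From mathcomp Require Import all_boot all_order all_algebra all_fingroup all_character.
From mathcomp Require Import boolp.
Require Import Defs.
Set Implicit Arguments.
Unset Strict Implicit.
Unset Printing Implicit Defensive.
Import GRing.Theory.
Local Open Scope ring_scope.

(** Write [X] for [dsum M a], [E] for its endomorphism ring, [u x] for the basis
    vector of [KF(X)] at [x], and [f x] for [fmap F f x].

    A nonzero intertwiner from [KF(X)] to [V] is nonzero on some [u m].  Since
    [V] receives nothing from functors below [F], the subfunctor generated by [m]
    is [F] ([intertwiner_generates]).  So [F] is generated by one element [m] of
    [F(X)], and every intertwiner kills the vectors [u x] with [x] not a
    generator.  Finite rings have stable range one ([stable_range1]), so any two
    generators are conjugate under Aut(X) ([generators_conj]).  Two consequences: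
    an intertwiner is determined by the image of [u m], which embeds
    [Hom(KF(X), V)] into [V]; and an automorphism [t] of [F], being determined by
    [t m], is induced by an automorphism of [X], whence |Aut F| <= |Aut X|.  That
    the bar part of [KF(X)] and [KF(X)] itself have the same intertwiners to [V]
    follows from Maschke's theorem ([bar_separates], [bar_retraction]).

    Suppose |Aut F| = |Aut X|.  Then every automorphism of [X] descends to [F] and
    only the identity fixes [m].  The annihilator [N] of [m] in [E] is therefore a
    left ideal, stable under right multiplication by units, such that 1 is the
    only unit in [1 + N]; such an ideal is generated by a central idempotent [e]
    of [E] ([ideal_gen_idem], [ideal_idem_central]).  Hence [F] looks like the
    functor represented by the summand [(1 - e) X] of [X]: its indecomposable
    summands are cut out by primitive idempotents of [E] orthogonal to [e]
    ([indec_summand_type]), and these correspond to the modules [M j]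
    ([primitive_split]).  If [e] is not zero, a type [M i] lying below [e] does not
    occur ([missing_type]), so that Supp(F) < n = Supp(X).

    Equality of all degrees thus forces [e = 0], which makes [f |-> f m] an
    isomorphism from the functor represented by [X] to [F] ([represented]).
    Evaluation at [u m] is then an equivariant embedding of the tilde
    representation into [V] ([evaluation]), and the dimensions agree. *)

(** * Finite rings *)

Section FiniteRing.
Variable E : finPzRingType.
Implicit Types (x y z c e f g b : E) (I : {set E}).

Lemma idem_power x : exists2 q, (0 < q)%N & x ^+ q * x ^+ q = x ^+ q.
Proof.
have /injectivePn[i [j ij hij]] : ~~ injectiveb (fun i : 'I_#|E|.+1 => x ^+ i).
  by apply/injectiveP => /leq_card; rewrite card_ord ltnn.
wlog lt_ij : i j ij hij / (i < j)%N.
  move=> W; case: (ltngtP i j) => [|ji|/val_inj eij]; first exact: W.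
    by apply: (W j i); rewrite // eq_sym.
  by rewrite eij eqxx in ij.
have per k t : (i <= k)%N -> x ^+ (k + t * (j - i)) = x ^+ k.
  move=> ik; elim: t => [|t IH]; first by rewrite addn0.
  rewrite mulSn addnA -(subnK ik) -addnA -addnA [(i + _)%N]addnA.
  rewrite subnKC ?(ltnW lt_ij) // addnA addnAC exprD -hij -exprD.
  by rewrite addnAC subnK.
(* A positive multiple of the period [j - i], past the preperiod [i]. *)
exists (i.+1 * (j - i))%N; first by rewrite muln_gt0 subn_gt0.
by rewrite -exprD per // -[X in (X <= _)%N]muln1 leq_mul ?leqnSn ?subn_gt0.
Qed.

Lemma unipotent_linv x k : x ^+ k = 0 -> exists y, y * (1 - x) = 1.
Proof.
move=> xk; exists (\sum_(i < k) x ^+ i); rewrite mulr_suml.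
transitivity (\sum_(0 <= i < k) (- x ^+ i.+1 - - x ^+ i)).
  by rewrite big_mkord; apply: eq_bigr => i _; rewrite mulrBr mulr1 -exprSr opprK addrC.
by rewrite telescope_sumr // xk oppr0 sub0r opprK expr0.
Qed.

Section StableRange.

Let lideal z := [set w * z | w : E].

Let lidealP z y : reflect (exists w, y = w * z) (y \in lideal z).
Proof. by apply: (iffP imsetP) => [[w _ ->]|[w ->]]; exists w. Qed.

Let lideal_sub z y : (lideal y \subset lideal z) = (y \in lideal z).
Proof.
apply/subsetP/lidealP => [/(_ y) yz|[w ->] _ /lidealP[v ->]].
  by apply/lidealP/yz/lidealP; exists 1; rewrite mul1r.
by apply/lidealP; exists (v * w); rewrite mulrA.
Qed.

Let lidealB z x y : x \in lideal z -> y \in lideal z -> x - y \in lideal z.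
Proof.
by move=> /lidealP[v ->] /lidealP[w ->]; apply/lidealP; exists (v - w); rewrite mulrBl.
Qed.

Let lidealD z x y : x \in lideal z -> y \in lideal z -> x + y \in lideal z.
Proof.
by move=> /lidealP[v ->] /lidealP[w ->]; apply/lidealP; exists (v + w); rewrite mulrDl.
Qed.

Let lidealM z w y : y \in lideal z -> w * y \in lideal z.
Proof.
by move=> /lidealP[v ->]; apply/lidealP; exists (w * v); rewrite mulrA.
Qed.

Variable b : E.
Let gens f I := [set y | (lideal y == I) && (y - f \in lideal b)].

(** Whether the coset [f + E b] meets a left ideal [I] depends on [I] only,
    when [E f + E b = E]: this happens just when [I + E b = E]; all such
    intersections are then translates of [I :&: E b].  Sorting the elements of
    the intersection by the left ideal that they generate, an induction over
    left ideals shows that the number of generators of [I] in the coset does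
    not depend on [f] either. *)
Lemma card_generators_coset f1 f2 g1 g2 I :
    g1 * f1 - 1 \in lideal b -> g2 * f2 - 1 \in lideal b ->
  #|gens f1 I| = #|gens f2 I|.
Proof.
move=> f1b f2b; have [k] := ubnP #|I|; elim: k I => // k IH I /ltnSE Ik.
have [/existsP[z /eqP Iz]|/existsPn noz] := boolP [exists z, I == lideal z]; last first.
  suff E0 f : gens f I = set0 by rewrite !E0.
  by apply/setP => y; rewrite !inE eq_sym (negPf (noz y)).
pose cut f := [set y in I | y - f \in lideal b].
have partE f : #|cut f| = (#|gens f I| + \sum_(J : {set E} | J \proper I) #|gens f J|)%N.
  rewrite -sum1_card (partition_big lideal (fun J => J \subset I)) /=; last first.
    by move=> y; rewrite !inE Iz lideal_sub => /andP[].
  rewrite (bigD1 I) //=; congr (_ + _)%N.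
    rewrite -sum1_card; apply: eq_bigl => y; rewrite !inE andbC.
    by case: eqP => // yI; rewrite -{1}yI -lideal_sub subxx.
  apply: eq_big => [J|J /andP[JI _]]; first by rewrite properEneq andbC.
  rewrite -sum1_card; apply: eq_bigl => y; rewrite !inE andbC.
  by case: eqP => // yJ; rewrite Iz -lideal_sub yJ -Iz JI.
have cut_le f g f' g' : g * f - 1 \in lideal b -> g' * f' - 1 \in lideal b ->
    (#|cut f| <= #|cut f'|)%N.
  move=> fb f'b; have [->|[y1]] := set_0Vmem (cut f); first by rewrite cards0.
  rewrite inE => /andP[y1I y1f].
  pose y2 := f' * g * y1.
  have y2I : y2 \in I by move: y1I; rewrite Iz => /lidealM; apply.
  have y2f : y2 - f' \in lideal b.
    have -> : y2 - f' = f' * (g * (y1 - f) + (g * f - 1)).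
      by rewrite mulrBr addrA subrK mulrBr mulr1 mulrA.
    by apply/lidealM/lidealD => //; apply: lidealM.
  rewrite -(card_imset (cut f) (addIr (y2 - y1))); apply: subset_leq_card.
  apply/subsetP => _ /imsetP[y + ->]; rewrite !inE => /andP[yI yf].
  apply/andP; split; first by move: yI y1I y2I; rewrite Iz => *; rewrite lidealD // lidealB.
  have -> : y + (y2 - y1) - f' = (y - f) - (y1 - f) + (y2 - f').
    by rewrite opprB [y - f + _]addrA subrK !addrA (addrAC y).
  by rewrite lidealD // lidealB.
have cutE : #|cut f1| = #|cut f2|.
  by apply/eqP; rewrite eqn_leq (cut_le _ g1 _ g2) // (cut_le _ g2 _ g1).
apply/eqP; rewrite -(eqn_add2r (\sum_(J : {set E} | J \proper I) #|gens f1 J|)).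
rewrite -partE cutE partE eqn_add2l; apply/eqP/eq_bigr => J /proper_card JI.
by rewrite IH // (leq_trans JI).
Qed.

(** Bass's theorem that a finite ring has stable range one.  The coset of 1
    contains a generator of the left ideal [E], namely 1; by the previous lemma
    the coset of [f] contains one too, and generators are left invertible. *)
Lemma stable_range1 f g : g * f + b = 1 -> exists t u, u * (f + t * b) = 1.
Proof.
move=> gfb.
have fb : g * f - 1 \in lideal b.
  by apply/lidealP; exists (-1); rewrite -[X in _ - X]gfb opprD addrA subrr sub0r mulN1r.
have ob : 1 * 1 - 1 \in lideal b.
  by apply/lidealP; exists 0; rewrite mul1r mul0r subrr.
have := card_generators_coset (lideal 1) fb ob.
have: (0 < #|gens 1%R (lideal 1%R)|)%N.
  by rewrite card_gt0; apply/set0Pn; exists 1; rewrite inE eqxx -[X in X - 1]mul1r.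
move=> + eq_card; rewrite -eq_card card_gt0 => /set0Pn[y].
rewrite inE => /andP[/eqP y1 /lidealP[t yf]]; exists t.
have /lidealP[u Eu] : 1 \in lideal y by rewrite y1; apply/lidealP; exists 1; rewrite mulr1.
by exists u; rewrite -yf addrC subrK -Eu.
Qed.

End StableRange.

Section Primitive.
Variable c : E.
Hypothesis prim : forall x, c * x * c = x -> x * x = x -> x = 0 \/ x = c.

(** The corner of a primitive idempotent [c] is a local ring: an element has an
    idempotent power, so it is nilpotent or left invertible, and when [w * x] is
    nilpotent, [c - w * x] is left invertible. *)
Lemma prim_linvD x y w : c * c = c -> c * x * c = x -> c * y * c = y ->
  w * (x + y) = c -> (exists v, v * x = c) \/ (exists v, v * y = c).
Proof.
move=> cc cx cy wc.
have xc : x * c = x by rewrite -cx -mulrA cc.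
have yc : y * c = y by rewrite -cy -mulrA cc.
set z := c * w * x; have [q q0 idq] := idem_power z.
have cz : c * z = z by rewrite /z !mulrA cc.
have zc : z * c = z by rewrite /z -mulrA xc.
have cX k : c * z ^+ k.+1 * c = z ^+ k.+1.
  by rewrite exprS mulrA cz -exprS exprSr -mulrA zc.
case: (prim _ idq) => [|xq|xq]; first by case: q q0 {idq} => // q _; apply: cX.
  right; have [u Eu] := unipotent_linv xq.
  exists (u * (c * w)); have -> : u * (c * w) * y = u * (1 - z) * c.
    rewrite -![in RHS]mulrA mulrBl mul1r zc -mulrA; congr (u * _).
    by apply/eqP; rewrite eq_sym subr_eq addrC -mulrDr -mulrA wc cc.
  by rewrite Eu mul1r.
left; case: q q0 xq {idq} => // q _ xq.
by exists (z ^+ q * (c * w)); rewrite -mulrA -exprSr.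
Qed.

Lemma prim_linv_sum (I : finType) (F : I -> E) : c * c = c -> c != 0 ->
    (forall i, c * F i * c = F i) -> \sum_i F i = c ->
  exists i v, v * F i = c.
Proof.
move=> cc c0 cF sumF.
have cS (r : seq I) : c * (\sum_(i <- r) F i) * c = \sum_(i <- r) F i.
  by rewrite mulr_sumr mulr_suml; apply: eq_bigr.
have: exists w, w * \sum_i F i = c by exists c; rewrite sumF.
elim: (index_enum I) => [[w]|i r IH [w]].
  by rewrite big_nil mulr0 => /esym/eqP; rewrite (negPf c0).
rewrite big_cons => /(prim_linvD cc (cF i) (cS r))[[v vi]|//].
by exists i, v.
Qed.
End Primitive.

(** A left ideal [N] that is stable under right multiplication by units, and for
    which no unit but 1 lies in [1 + N].  For an idempotent [e] in [N], the
    elements [(1 - e) x e] and [e x (1 - e)] have square zero and lie in [N]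
    (the second because [e (1 + e x (1 - e))] does), hence vanish: [e] is
    central.  As nilpotent elements of [N] vanish as well, every nonzero
    element of [N] has a nonzero idempotent power. *)
Section UnipotentFreeIdeal.
Variable N : E -> Prop.
Hypothesis NB : forall x y, N x -> N y -> N (x - y).
Hypothesis NM : forall z x, N x -> N (z * x).
Hypothesis Nunipotent : forall x y, N x -> y * (1 + x) = 1 -> x = 0.
Hypothesis Nunit : forall x u v, N x -> v * u = 1 -> N (x * u).

Let N0 x : N x -> N 0.
Proof. by move=> Nx; have := NB Nx Nx; rewrite subrr. Qed.
Let ND x y : N x -> N y -> N (x + y).
Proof. by move=> Nx Ny; have := NB (N0 Ny) Ny; rewrite sub0r => /(NB Nx); rewrite opprK. Qed.

Lemma nil_ideal0 x k : N x -> x ^+ k = 0 -> x = 0.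
Proof.
move=> Nx xk; have [|y] := @unipotent_linv (- x) k.
  by rewrite exprNn xk mulr0.
by rewrite opprK; apply: Nunipotent.
Qed.

Lemma ideal_idem_central e x : N e -> e * e = e -> e * x = x * e.
Proof.
move=> Ne ee.
have e1 : e * (1 - e) = 0 by rewrite mulrBr mulr1 ee subrr.
have e1' : (1 - e) * e = 0 by rewrite mulrBl mul1r ee subrr.
pose s := (1 - e) * x * e; pose t := e * x * (1 - e).
have s0 : s = 0.
  apply: (@nil_ideal0 _ 2); first exact: NM.
  by rewrite expr2 /s !mulrA -(mulrA _ e) e1 mulr0 !mul0r.
have t2 : t ^+ 2 = 0 by rewrite expr2 /t !mulrA -(mulrA _ (1 - e)) e1' mulr0 !mul0r.
have t0 : t = 0.
  apply: (nil_ideal0 _ t2).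
  have [|v] := @unipotent_linv (- t) 2; first by rewrite exprNn t2 mulr0.
  rewrite opprK => /(Nunit Ne) Nt.
  have -> : t = e * (1 + t) - e by rewrite mulrDr mulr1 {2}/t !mulrA ee -/t addrAC subrr add0r.
  exact: NB.
move: s0 t0; rewrite /s /t mulrBr mulr1 mulrBl mul1r mulrBl => /eqP + /eqP.
by rewrite !subr_eq0 => /eqP xe /eqP ->.
Qed.

Lemma ideal_idem_power f : N f -> f != 0 ->
  exists q, [/\ N (f ^+ q.+1), f ^+ q.+1 * f ^+ q.+1 = f ^+ q.+1 & f ^+ q.+1 != 0].
Proof.
move=> Nf f0; have [[//|q] _ idq] := idem_power f; exists q; split => //.
  by rewrite exprSr; apply: NM.
by apply: contraNneq f0 => /(nil_ideal0 Nf) ->.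
Qed.

(** Take an idempotent [e] of [N] with [E e] as large as possible.  If [f - f e]
    were not zero, some power [g] of it would be a nonzero idempotent orthogonal
    to [e], and [e + g] would generate a larger ideal. *)
Lemma ideal_gen_idem : N 0 ->
  exists e, [/\ N e, e * e = e & forall f, N f -> f * e = f].
Proof.
move=> N00; pose P e := `[< N e /\ e * e = e >].
have P0 : P 0 by apply/asboolP; rewrite mulr0.
have [e /asboolP[Ne ee] emax] := @arg_maxnP _ 0 P (fun e => #|[set w * e | w : E]|) P0.
exists e; split=> // f Nf; apply/eqP; rewrite eq_sym -subr_eq0.
have [//|nz] := eqVneq (f - f * e) 0.
have Nf' : N (f - f * e) by apply: NB => //; apply: NM.
have [q [Ng gg g0]] := ideal_idem_power Nf' nz; set g := _ ^+ q.+1 in Ng gg g0.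
have ge : g * e = 0.
  by rewrite /g exprSr -mulrA mulrBl -(mulrA f) ee subrr mulr0.
have eg : e * g = 0 by rewrite ideal_idem_central.
have P' : P (e + g).
  apply/asboolP; split; first exact: ND.
  by rewrite mulrDl !mulrDr ee eg ge gg add0r addr0.
have /= := emax _ P'; rewrite leqNgt => /negP[].
apply: proper_card; apply/properP; split.
  apply/subsetP => _ /imsetP[w _ ->]; apply/imsetP; exists (w * e) => //.
  by rewrite mulrDr -!mulrA ee eg mulr0 addr0.
exists g; first by apply/imsetP; exists g => //; rewrite mulrDr ge gg add0r.
apply/imsetP => -[w _ gw]; case/negP: g0; apply/eqP.
by rewrite -gg {1}gw -mulrA eg mulr0.
Qed.
End UnipotentFreeIdeal.

End FiniteRing.

(** * Modules: endomorphism rings, submodules and retracts *)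

Section HomComposition.
Variable S : finNzRingType.
Implicit Types A B C D : finLmodType S.

Lemma comphomE A B C (g : hom B C) (f : hom A B) x : comphom g f x = g (f x).
Proof. exact: mkhomE. Qed.

Lemma idhomE A x : idhom A x = x.
Proof. exact: mkhomE. Qed.

Lemma comphomA A B C D (h : hom C D) (g : hom B C) (f : hom A B) :
  comphom h (comphom g f) = comphom (comphom h g) f.
Proof. by apply/homP => x; rewrite !comphomE. Qed.

Lemma comp1hom A B (f : hom A B) : comphom (idhom B) f = f.
Proof. by apply/homP => x; rewrite comphomE idhomE. Qed.

Lemma comphom1 A B (f : hom A B) : comphom f (idhom A) = f.
Proof. by apply/homP => x; rewrite comphomE idhomE. Qed.

Lemma comphomDl A B C (g1 g2 : hom B C) (f : hom A B) :
  comphom (g1 + g2) f = comphom g1 f + comphom g2 f.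
Proof. by apply/homP => x; rewrite !(comphomE, hom_addE). Qed.

Lemma comphomDr A B C (g : hom B C) (f1 f2 : hom A B) :
  comphom g (f1 + f2) = comphom g f1 + comphom g f2.
Proof. by apply/homP => x; rewrite !(comphomE, hom_addE) linearD. Qed.

Lemma comphom0 A B C (g : hom B C) : comphom g (0 : hom A B) = 0.
Proof. by apply/homP => x; rewrite comphomE !hom_0E linear0. Qed.

Lemma comp0hom A B C (f : hom A B) : comphom (0 : hom B C) f = 0.
Proof. by apply/homP => x; rewrite comphomE !hom_0E. Qed.

Lemma hom_oppE A B (f : hom A B) x : (- f) x = - f x.
Proof. exact: mkhomE. Qed.

Lemma hom_sumE A B (I : Type) (r : seq I) (P : pred I) (f : I -> hom A B) x :
  (\sum_(i <- r | P i) f i) x = \sum_(i <- r | P i) f i x.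
Proof.
by apply: (big_morph (fun g : hom A B => g x)) => [g h|]; rewrite ?hom_addE ?hom_0E.
Qed.

End HomComposition.

HB.instance Definition _ (S : finNzRingType) (A : finLmodType S) :=
  GRing.Zmodule_isPzRing.Build (hom A A) (@comphomA S A A A A)
    (@comp1hom S A A) (@comphom1 S A A)
    (@comphomDl S A A A) (fun f g h => @comphomDr S A A A f g h).

Section Endomorphisms.
Variables (S : finNzRingType) (A : finLmodType S).
Implicit Types f g : hom A A.
Lemma mulhomE f g : f * g = comphom f g. Proof. by []. Qed.
Lemma onehomE : 1 = idhom A. Proof. by []. Qed.
End Endomorphisms.

(** The closure proof is a parameter of the type, so that its module structure
    can be inferred. *)
Record submod (S : finNzRingType) (A : finLmodType S) (P : pred A)
  (clP : submod_closed P) := Submod { submod_val : A; _ : P submod_val }.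

Section Submodule.
Variables (S : finNzRingType) (A : finLmodType S) (P : pred A).
Variable clP : submod_closed P.
HB.instance Definition _ := [isSub for @submod_val S A P clP].
HB.instance Definition _ := [Finite of submod clP by <:].
HB.instance Definition _ := GRing.SubChoice_isSubLmodule.Build _ _ _ (submod clP)
  (GRing.submod_closed_semi clP).

Lemma submod_val_linear : linear (@submod_val S A P clP).
Proof. by []. Qed.
Definition submod_hom : hom (submod clP) A := mkhom submod_val_linear.

Lemma submod_homE x : submod_hom x = submod_val x.
Proof. exact: mkhomE. Qed.

Lemma submod_hom_inj : injective submod_hom.
Proof. by move=> x y; rewrite !submod_homE; apply: val_inj. Qed.

Lemma submod_homP x : P (submod_hom x).
Proof. by rewrite submod_homE; apply: valP. Qed.

Variables (B : finLmodType S) (f : hom B A).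
Hypothesis fP : forall x, P (f x).

Lemma submod_lift_linear : linear (fun x => Submod clP (fP x)).
Proof. by move=> k x y; apply: val_inj; rewrite /= !linearP. Qed.
Definition submod_lift : hom B (submod clP) := mkhom submod_lift_linear.

Lemma submod_liftE x : submod_hom (submod_lift x) = f x.
Proof. by rewrite submod_homE mkhomE. Qed.
End Submodule.

Section Retracts.
Variable S : finNzRingType.
Implicit Types A B X : finLmodType S.

Fact ker_submod A X (f : hom X A) : submod_closed (fun x => f x == 0).
Proof.
split; first by rewrite unfold_in linear0.
by move=> k x y; rewrite !unfold_in => /eqP fx /eqP fy; rewrite linearP /= fx fy scaler0 addr0.
Qed.

Fact fix_submod A (f : hom A A) : submod_closed (fun x => f x == x).
Proof.
split; first by rewrite unfold_in linear0.
by move=> k x y; rewrite !unfold_in => /eqP fx /eqP fy; rewrite linearP /= fx fy.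
Qed.

Lemma retract_dsum A X (i : hom A X) (p : hom X A) :
  comphom p i = idhom A -> mod_dsum X A (submod (ker_submod p)).
Proof.
move=> pi; have piE x : p (i x) = x by rewrite -comphomE pi idhomE.
pose f (z : A * submod (ker_submod p)) := i z.1 + submod_hom _ z.2.
have fl : linear f by move=> k z t; rewrite /f /= !linearP scalerDr addrACA.
have pE (y : submod (ker_submod p)) : p (submod_hom _ y) = 0.
  exact/eqP/(submod_homP y).
pose L := GRing.isLinear.Build S (A * submod (ker_submod p))%type X *:%R f fl.
exists (HB.pack_for {linear (A * submod (ker_submod p))%type -> X} f L) => /=.
have qP x : p (x - i (p x)) == 0 by rewrite linearB /= piE subrr.
exists (fun x => (p x, Submod (ker_submod p) (qP x))).
  move=> [x y]; rewrite /f /=; congr pair; first by rewrite linearD /= piE pE addr0.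
  apply: val_inj => /=; rewrite linearD /= piE pE addr0 addrC addKr.
  by rewrite submod_homE.
by move=> x; rewrite /f /= submod_homE /= addrC subrK.
Qed.

Lemma dsum_retract A B X : mod_dsum X A B ->
  exists (i : hom A X) (p : hom X A), comphom p i = idhom A.
Proof.
case=> f [g fK gK].
have il : linear (fun x : A => f (x, 0)).
  move=> k x y; rewrite -linearP; congr (f _).
  by apply: injective_projections; rewrite //= scaler0 addr0.
have pl : linear (fun x : X => (g x).1).
  move=> k x y; rewrite (_ : g _ = k *: g x + g y) //.
  by apply: (can_inj fK); rewrite linearP !gK.
by exists (mkhom il), (mkhom pl); apply/homP => x; rewrite comphomE !mkhomE fK.
Qed.

(** The image and the kernel of an idempotent decompose the module. *)
Lemma indec_idem A (e : hom A A) : mod_indec A -> e * e = e -> e = 0 \/ e = 1.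
Proof.
move=> [_ indA] ee; have eE x : e (e x) = e x by rewrite -{3}ee mulhomE comphomE.
have eP x : e (e x) == e x by rewrite eE.
pose i := submod_hom (fix_submod e); pose p := submod_lift (fix_submod e) eP.
have pi : comphom p i = idhom _.
  apply/homP => x; apply: (@submod_hom_inj _ _ _ (fix_submod e)).
  by rewrite comphomE submod_liftE idhomE; apply/eqP/(submod_homP x).
case: (indA _ _ (retract_dsum pi)) => z0; [left|right]; apply/homP => x.
  rewrite hom_0E -[e x](submod_liftE (fix_submod e) eP) -/p (z0 (p x)).
  by rewrite linear0.
have kP : p (x - e x) == 0.
  rewrite linearB /= subr_eq0; apply/eqP/(@submod_hom_inj _ _ _ (fix_submod e)).
  by rewrite !submod_liftE eE.
have /(congr1 (submod_hom _)) := z0 (Submod (ker_submod p) kP).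
rewrite linear0 submod_homE /= => /eqP; rewrite subr_eq0 => /eqP <-.
by rewrite onehomE idhomE.
Qed.

Lemma mod_iso_sym A B : mod_iso A B -> mod_iso B A.
Proof.
case=> f [g fK gK]; have gl : linear g.
  by move=> k x y; apply: (can_inj fK); rewrite linearP /= !gK.
by exists (mkhom gl); exists f => x; rewrite mkhomE ?fK ?gK.
Qed.

Lemma mod_iso_trans A B X : mod_iso A B -> mod_iso B X -> mod_iso A X.
Proof.
move=> [f bf] [g bg]; exists (comphom g f).
by apply: (eq_bij (bij_comp bg bf)) => x; rewrite comphomE.
Qed.

End Retracts.

(** * Summands of a sum of indecomposable modules *)

Section Summands.
Variables (S : finNzRingType) (n : nat) (M : 'I_n -> finLmodType S).

Section Coordinates.
Variable b : 'I_n -> nat.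
Local Notation X := (dsum M b : finLmodType S).
Implicit Types k : {i : 'I_n & 'I_(b i)}.

Fact inj_linear k : linear (fun x : M (tag k) =>
  [ffun k' => dfwith (fun j : {i : 'I_n & 'I_(b i)} => 0 : M (tag j)) x k'] : X).
Proof.
move=> c x y; apply/ffunP => k'; rewrite dsum_addE dsum_scaleE !ffunE.
case: (eqVneq k k') => [<-|kk']; first by rewrite !dfwith_in.
by rewrite !dfwith_out // scaler0 addr0.
Qed.
Definition dinj k : hom (M (tag k)) X := mkhom (@inj_linear k).

Fact proj_linear k : linear (fun x : X => x k).
Proof. by move=> c x y; rewrite dsum_addE dsum_scaleE. Qed.
Definition dproj k : hom X (M (tag k)) := mkhom (@proj_linear k).

Lemma dinjK k : comphom (dproj k) (dinj k) = idhom _.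
Proof. by apply/homP => x; rewrite comphomE !mkhomE ffunE dfwith_in. Qed.

Lemma sum_dinj_dproj : \sum_k comphom (dinj k) (dproj k) = idhom X.
Proof.
apply/homP => x; apply/ffunP => k; rewrite hom_sumE idhomE dsum_sumE (bigD1 k) //=.
rewrite big1 => [|j jk]; first by rewrite addr0 comphomE !mkhomE ffunE dfwith_in.
by rewrite comphomE !mkhomE ffunE dfwith_out.
Qed.
End Coordinates.

Hypothesis indecM : forall i, mod_indec (M i).
Variable a : 'I_n -> nat.
Local Notation X := (dsum M a : finLmodType S).

Definition primitive (c : hom X X) :=
  [/\ c * c = c, c != 0
    & forall x, c * x * c = x -> x * x = x -> x = 0 \/ x = c].

(** The corner of a primitive idempotent [c] is local, so that one of the
    summands [c * (dinj k \o dproj k) * c] of [c] is invertible there; this makes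
    the image of [c] a nonzero direct summand of the indecomposable [M (tag k)]. *)
Lemma primitive_split c : primitive c -> exists j (f : hom X (M j)) (g : hom (M j) X),
  comphom g f = c /\ comphom f g = idhom (M j).
Proof.
move=> [cc c0 prim].
pose F k : hom X X := c * comphom (dinj k) (dproj k) * c.
have [||k [v vF]] := @prim_linv_sum _ c prim _ F cc c0.
- by move=> k; rewrite /F !mulrA cc -mulrA cc.
- by rewrite /F -mulr_suml -mulr_sumr sum_dinj_dproj -onehomE mulr1 cc.
pose f := comphom (dproj k) c.
pose g := comphom (c * v * c) (dinj k).
have gf : comphom g f = c.
  transitivity (c * (v * F k)); last by rewrite vF cc.
  by rewrite /f /g /F -(comphomA _ (dinj k)) (comphomA (dinj k)) -!mulhomE !mulrA.
exists (tag k), f, g; split=> //.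
have ii : comphom f g * comphom f g = comphom f g.
  rewrite mulhomE -(comphomA f g) (comphomA g f) gf.
  by congr comphom; rewrite /g comphomA -mulhomE !mulrA cc.
case: (indec_idem (indecM (tag k)) ii) => // fg0.
case/eqP: c0; rewrite -cc mulhomE -{1}gf -gf -(comphomA g f) (comphomA f g) fg0.
by rewrite comp0hom comphom0.
Qed.

(** An idempotent [x] below [comphom i p] comes from the idempotent [p x i]
    of [A]. *)
Lemma indec_primitive (A : finLmodType S) (i : hom A X) (p : hom X A) :
  mod_indec A -> comphom p i = idhom A -> primitive (comphom i p).
Proof.
move=> indA pi.
have cc : comphom i p * comphom i p = comphom i p.
  by rewrite mulhomE -(comphomA i p) (comphomA p i) pi comp1hom.
split=> // [|x cx xx].
  case: indA => A0 _; apply/eqP => ip0; case: A0 => x.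
  have : comphom (comphom p i) (comphom p i) x = x by rewrite pi comp1hom idhomE.
  by rewrite -(comphomA p i) (comphomA i p) ip0 comp0hom comphom0 hom_0E => <-.
have xc : x * comphom i p = x by rewrite -{1}cx -mulrA cc.
pose y : hom A A := comphom p (comphom x i).
have yx : x = comphom i (comphom y p).
  by rewrite /y -{1}cx !mulhomE !comphomA.
have yy : y * y = y.
  rewrite mulhomE /y -!(comphomA p); congr comphom.
  by rewrite !comphomA -(comphomA x i p) -!mulhomE xc xx.
case: (indec_idem indA yy) => y1; [left|right]; rewrite yx y1.
  by rewrite comp0hom comphom0.
by rewrite onehomE comp1hom.
Qed.

Lemma indec_summand_iso (A B : finLmodType S) :
  mod_indec A -> mod_dsum X A B -> exists j, mod_iso A (M j).
Proof.
move=> indA /dsum_retract[i [p pi]].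
have [j [f [g [gf fg]]]] := primitive_split (indec_primitive indA pi).
exists j, (comphom f i), (comphom p g) => x; rewrite -comphomE.
  rewrite -(comphomA p g) (comphomA g f) gf -(comphomA i p) pi comphom1 pi.
  by rewrite idhomE.
by rewrite -(comphomA f i) (comphomA i p) -gf -(comphomA g f) fg comphom1 fg idhomE.
Qed.

End Summands.

Section Counting.
Variables (T : Type) (P : T -> Prop) (E : T -> T -> Prop).

(** The relation [L] labels objects so that equally labelled ones are
    equivalent. *)
Lemma class_count_le (J : finType) (D : {set J}) (L : T -> J -> Prop) :
    (forall x, P x -> exists2 j, j \in D & L x j) ->
    (forall x y j, P x -> P y -> L x j -> L y j -> E x y) ->
  (class_count P E <= #|D|)%N.
Proof.
move=> PL LE; rewrite /class_count; case: classical_sets.xgetP => // k _ [N [PN NE _]].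
have /choice[h hP] : forall i, exists j, j \in D /\ L (N i) j.
  by move=> i; have [j jD Lj] := PL _ (PN i); exists j.
rewrite -[X in (X <= _)%N]card_ord -(@card_imset _ _ h).
  by apply/subset_leq_card/subsetP => _ /imsetP[i _ ->]; case: (hP i).
move=> i j hij; apply/NE/(LE _ _ (h i)) => //; first by case: (hP i).
by rewrite hij; case: (hP j).
Qed.

Lemma class_count_ge n (N : 'I_n -> T) :
    (forall x y, E x y -> E y x) -> (forall x y z, E x y -> E y z -> E x z) ->
    (forall i, P (N i)) -> (forall i j, E (N i) (N j) -> i = j) ->
    (forall x, P x -> exists i, E x (N i)) ->
  (n <= class_count P E)%N.
Proof.
move=> Esym Etrans PN NE cov.
have [N' [_ _ cov']] : num_classes P E (class_count P E).
  by apply: classical_sets.xgetPex; exists n, N.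
have /choice[h hP] i : exists j, E (N i) (N' j) by apply: cov'.
rewrite -[X in (X <= _)%N]card_ord -[X in (_ <= X)%N]card_ord; apply: (@leq_card _ _ h).
by move=> i j hij; apply/NE/(Etrans _ _ _ (hP i)); rewrite hij; apply/Esym/hP.
Qed.
End Counting.

(** By [indec_summand_iso] the modules [M i] represent all classes, so the count
    is not the default value 0. *)
Lemma suppM_ge (S : finNzRingType) n (M : 'I_n -> finLmodType S) (a : 'I_n -> nat) :
    (forall i, mod_indec (M i)) -> (forall i j, i != j -> ~ mod_iso (M i) (M j)) ->
    (forall i, (1 <= a i)%N) ->
  (n <= suppM (dsum M a))%N.
Proof.
move=> indM nisoM a1; apply: (@class_count_ge _ _ _ _ M).
- exact: mod_iso_sym.
- exact: mod_iso_trans.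
- move=> i; split=> //.
  pose k : {i : 'I_n & 'I_(a i)} := Tagged (fun i => 'I_(a i)) (Ordinal (a1 i)).
  by exists (submod (ker_submod (dproj M k))); apply: (retract_dsum (dinjK M k)).
- by move=> i j Eij; apply/eqP/negPn/negP => /nisoM.
- by move=> A [indA [B /(indec_summand_iso indM indA)]].
Qed.

(** * Functors: subfunctors, generators and idempotents *)

Section Functors.
Variables (ol : finComNzRingType) (R : finAlgType ol).
Variables (n : nat) (M : 'I_n -> finLmodType R).
Local Notation obj := ('I_n -> nat).
Local Notation X b := (dsum M b : finLmodType R).
Implicit Types F G A B : functor M.

Lemma fmap_idE F b (x : F b) : fmap F (idhom (X b)) x = x.
Proof. by rewrite fmap_id idhomE. Qed.

Lemma fmap_compE F b c d (g : hom (X c) (X d)) (f : hom (X b) (X c)) x :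
  fmap F (comphom g f) x = fmap F g (fmap F f x).
Proof. by rewrite fmap_comp comphomE. Qed.

Lemma fmapD F b c (f g : hom (X b) (X c)) x :
  fmap F (f + g) x = fmap F f x + fmap F g x.
Proof. by have := fmap_linear 1 f g x; rewrite !scale1r. Qed.

Lemma fmap0 F b c x : fmap F (0 : hom (X b) (X c)) x = 0.
Proof. by apply: (@addrI _ (fmap F 0 x)); rewrite -fmapD !addr0. Qed.

Lemma fmapN F b c (f : hom (X b) (X c)) x : fmap F (- f) x = - fmap F f x.
Proof. by apply/eqP; rewrite -addr_eq0 -fmapD addNr fmap0. Qed.

Lemma fmapB F b c (f g : hom (X b) (X c)) x :
  fmap F (f - g) x = fmap F f x - fmap F g x.
Proof. by rewrite fmapD fmapN. Qed.

Section Composition.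
Variables (F G H : functor M) (t : nat_trans G H) (s : nat_trans F G).
Fact nt_comp_natural b c (f : hom (X b) (X c)) (x : F b) :
  comphom (t c) (s c) (fmap F f x) = fmap H f (comphom (t b) (s b) x).
Proof. by rewrite !comphomE !nt_natural. Qed.
Definition nt_comp : nat_trans F H := NatTrans nt_comp_natural.
Lemma nt_compE b x : nt_comp b x = t b (s b x).
Proof. exact: comphomE. Qed.
End Composition.

Lemma functor_dsum_retract F A B : functor_dsum F A B ->
  exists (s : nat_trans A F) (r : nat_trans F A), forall b x, r b (s b x) = x.
Proof.
move=> [s [t bij]]; exists s.
have h (b : obj) : exists r : F b -> A b,
    forall y, exists z, y = s b (r y) + t b z.
  have [g _ gK] := bij b; exists (fun y => (g y).1) => y.
  by exists (g y).2; rewrite gK.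
pose r b := projT1 (cid (h b)).
have rP b y : exists z, y = s b (r b y) + t b z := projT2 (cid (h b)) y.
have rE b (x : A b) z : r b (s b x + t b z) = x.
  have [z' /esym] := rP b (s b x + t b z).
  by move=> /(@bij_inj _ _ _ (bij b) (_, z') (_, z)) [].
have rl b : linear (r b).
  move=> k x y; have [z xz] := rP b x; have [w yw] := rP b y.
  rewrite {1}xz {1}yw scalerDr addrACA -!linearZ -!linearD /=; exact: rE.
have rn b c (f : hom (X b) (X c)) (x : F b) :
    mkhom (rl c) (fmap F f x) = fmap A f (mkhom (rl b) x).
  rewrite !mkhomE; have [z {1}->] := rP b x.
  by rewrite linearD /= -!nt_natural rE.
by exists (NatTrans rn) => b x; rewrite /= mkhomE -[s b x]addr0 -(linear0 (t b)) rE.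
Qed.

Section Subfunctor.
Variables (F : functor M) (P : forall b : obj, pred (F b)).
Hypothesis clP : forall b, submod_closed (@P b).
Hypothesis stP : forall b c (f : hom (X b) (X c)) x, P x -> P (fmap F f x).

Fact subfunctor_st b c (f : hom (X b) (X c)) x :
  P (comphom (fmap F f) (submod_hom (clP b)) x).
Proof. by rewrite comphomE; apply/stP/submod_homP. Qed.

Let smap b c (f : hom (X b) (X c)) : hom (submod (clP b)) (submod (clP c)) :=
  submod_lift (clP c) (subfunctor_st f).

Let smapE b c (f : hom (X b) (X c)) x :
  submod_hom (clP c) (smap f x) = fmap F f (submod_hom (clP b) x).
Proof. by rewrite submod_liftE comphomE. Qed.

Fact subfunctor_id b : smap (idhom (X b)) = idhom _.
Proof.
apply/homP => x; apply: (@submod_hom_inj _ _ _ (clP b)).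
by rewrite smapE fmap_idE idhomE.
Qed.
Fact subfunctor_comp b c d (g : hom (X c) (X d)) (f : hom (X b) (X c)) :
  smap (comphom g f) = comphom (smap g) (smap f).
Proof.
apply/homP => x; apply: (@submod_hom_inj _ _ _ (clP d)).
by rewrite comphomE !smapE fmap_compE.
Qed.
Fact subfunctor_linear b c (k : ol) (f g : hom (X b) (X c)) x :
  smap (k *: f + g) x = k *: smap f x + smap g x.
Proof.
by apply: (@submod_hom_inj _ _ _ (clP c)); rewrite linearP /= !smapE fmap_linear.
Qed.

Definition subfunctor : functor M :=
  Functor subfunctor_id subfunctor_comp subfunctor_linear.

Fact subfunctor_incl_natural b c (f : hom (X b) (X c)) (x : subfunctor b) :
  submod_hom (clP c) (fmap subfunctor f x) = fmap F f (submod_hom (clP b) x).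
Proof. exact: smapE. Qed.
Definition subfunctor_incl : nat_trans subfunctor F :=
  NatTrans subfunctor_incl_natural.

Lemma subfunctor_inclP b (x : subfunctor b) : P (subfunctor_incl b x).
Proof. exact: submod_homP. Qed.

Lemma subfunctor_incl_inj b : injective (subfunctor_incl b).
Proof. exact: submod_hom_inj. Qed.

Lemma subfunctor_sub b (x : F b) : P x -> exists y, subfunctor_incl b y = x.
Proof. by move=> Px; exists (Submod (clP b) Px); rewrite /= submod_homE. Qed.

(** A proper subfunctor is not isomorphic to the whole functor, because the
    values of functors are finite. *)
Lemma subfunctor_prec b (x : F b) : ~~ P x -> prec subfunctor F.
Proof.
move=> Px; split.
  exists subfunctor, subfunctor_incl.
  have idn c d (f : hom (X c) (X d)) (y : subfunctor c) :
    idhom (subfunctor d) (fmap subfunctor f y) = fmap subfunctor f (idhom (subfunctor c) y).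
    by rewrite !idhomE.
  exists (NatTrans idn); split; first exact: subfunctor_incl_inj.
  by move=> c y; exists y; rewrite /= idhomE.
case=> s; have /bij_eq_card eq_card := ni_bij s b.
have /imsetP[y _ xy] : x \in [set subfunctor_incl b y | y : subfunctor b].
  suff -> : [set subfunctor_incl b y | y : subfunctor b] = [set: F b] by rewrite inE.
  apply/eqP; rewrite eqEcard subsetT cardsT -eq_card card_imset ?leqnn //.
  exact: subfunctor_incl_inj.
by case/negP: Px; rewrite xy subfunctor_inclP.
Qed.
End Subfunctor.

Section FunctorIdempotent.
Variables (A : functor M) (p : nat_trans A A).

Fact fix_stable b c (f : hom (X b) (X c)) x :
  p b x == x -> p c (fmap A f x) == fmap A f x.
Proof. by rewrite nt_natural => /eqP ->. Qed.

Fact ker_stable b c (f : hom (X b) (X c)) x :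
  p b x == 0 -> p c (fmap A f x) == 0.
Proof. by rewrite nt_natural => /eqP ->; rewrite linear0. Qed.

(** As for modules, the image and the kernel of an idempotent endomorphism are
    complementary subfunctors. *)
Lemma functor_indec_idem : functor_indec A -> (forall b x, p b (p b x) = p b x) ->
  (forall b x, p b x = 0) \/ (forall b x, p b x = x).
Proof.
move=> [_ indA] pp.
pose i := subfunctor_incl (fun b => fix_submod (p b)) fix_stable.
pose j := subfunctor_incl (fun b => ker_submod (p b)) ker_stable.
have piE b y : p b (i b y) = i b y.
  exact/eqP/(subfunctor_inclP y).
have pjE b y : p b (j b y) = 0.
  exact/eqP/(subfunctor_inclP y).
have dAB : functor_dsum A (subfunctor (fun b => fix_submod (p b)) fix_stable)
                          (subfunctor (fun b => ker_submod (p b)) ker_stable).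
  exists i, j => b.
  have fP x : p b (p b x) == p b x by rewrite pp.
  have kP x : p b (x - p b x) == 0 by rewrite linearB /= pp subrr.
  exists (fun x => (Submod (fix_submod (p b)) (fP x), Submod (ker_submod (p b)) (kP x))).
    move=> [y z] /=; congr pair; apply: val_inj => /=.
      by rewrite linearD /= piE pjE addr0 /i /= submod_homE.
    by rewrite linearD /= piE pjE addr0 addrC addKr /j /= submod_homE.
  by move=> x /=; rewrite !submod_homE /= addrC subrK.
case: (indA _ _ dAB) => z0; [left|right] => b x.
  have [|y <-] := @subfunctor_sub _ _ (fun b => fix_submod (p b)) fix_stable b (p b x).
    by rewrite pp.
  by rewrite (z0 b y) linear0.
have [|y] := @subfunctor_sub _ _ (fun b => ker_submod (p b)) ker_stable b (x - p b x).
  by rewrite linearB /= pp subrr.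
by rewrite (z0 b y) linear0 => /esym/eqP; rewrite subr_eq0 => /eqP.
Qed.
End FunctorIdempotent.

Section Generators.
Variable a : obj.

Definition generates F (x : F a) := forall b (y : F b), exists f, fmap F f x = y.

Section Generated.
Variables (F : functor M) (x : F a).

Fact gen_submod b : submod_closed (fun y : F b => [exists f, fmap F f x == y]).
Proof.
split; first by rewrite unfold_in; apply/existsP; exists 0; rewrite fmap0.
move=> k y z; rewrite !unfold_in => /existsP[f /eqP <-] /existsP[g /eqP <-].
by apply/existsP; exists (k *: f + g); rewrite fmap_linear.
Qed.

Fact gen_stable b c (f : hom (X b) (X c)) (y : F b) :
  [exists g, fmap F g x == y] -> [exists g, fmap F g x == fmap F f y].
Proof.
by case/existsP=> g /eqP <-; apply/existsP; exists (comphom f g); rewrite fmap_compE.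
Qed.

Definition generated := subfunctor gen_submod gen_stable.

Lemma generates_or_prec : generates x \/ prec generated F.
Proof.
have [gen|/existsNP[b /existsNP[y ny]]] := pselect (generates x); [by left|right].
apply: (@subfunctor_prec _ _ gen_submod gen_stable b y).
by apply/existsPn => f; apply/eqP => fx; apply: ny; exists f.
Qed.

Lemma mem_generated : exists y, subfunctor_incl gen_submod gen_stable a y = x.
Proof.
by apply: subfunctor_sub; apply/existsP; exists (idhom _); rewrite fmap_idE.
Qed.
End Generated.

(** Every object is a direct summand of a power of [X a], since each [M i]
    occurs in [X a]; so the morphisms to [X a] separate elements. *)
Lemma fmap_separates F (ha : forall i, (1 <= a i)%N) b (y : F b) :
  (forall h : hom (X b) (X a), fmap F h y = 0) -> y = 0.
Proof.
move=> hy; rewrite -(fmap_idE y) -sum_dinj_dproj fmap_sum big1 // => k _.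
pose k' : {i : 'I_n & 'I_(a i)} :=
  Tagged (fun i => 'I_(a i)) (Ordinal (ha (tag k))).
have -> : comphom (dinj M k) (dproj M k)
    = comphom (comphom (dinj M k) (dproj M k' : hom (X a) (M (tag k))))
              (comphom (dinj M k' : hom (M (tag k)) (X a)) (dproj M k)).
  by rewrite !comphomA -(comphomA (dinj M k)) (dinjK M k') comphom1.
by rewrite fmap_compE hy linear0.
Qed.

Lemma linv_autR (u v : hom (X a) (X a)) : v * u = 1 ->
  exists s : autR (X a), autR_hom s = u.
Proof.
move=> vu; have uI : injective u.
  move=> y z; move/(congr1 v); rewrite -!comphomE -!mulhomE vu.
  by rewrite !onehomE !idhomE.
have us : perm uI \in autR_set (X a).
  by apply/autR_setP => k y z; rewrite !permE linearP.
exists (subg (autR_group (X a)) (perm uI)).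
by apply/homP => y; rewrite mkhomE subgK // permE.
Qed.

(** Two generators [m] and [x = f m] of [F a] differ by an automorphism of [X a]:
    if [m = g x], then [1 - g f] kills [m] and some [f + t (1 - g f)] is
    invertible. *)
Lemma generators_conj F (m x : F a) : generates m -> generates x ->
  exists u : autR (X a), fmap F (autR_hom u) m = x.
Proof.
move=> gm gx; have [f fm] := gm _ x; have [g gx'] := gx _ m.
have [|t [v vu]] := @stable_range1 (hom (X a) (X a)) (1 - g * f) f g.
  by rewrite addrC subrK.
have [s su] := linv_autR vu; exists s.
rewrite su fmapD mulhomE fmap_compE fmapB fmap_compE fm gx' onehomE fmap_idE.
by rewrite subrr linear0 addr0.
Qed.

Lemma nat_iso_generates F G (s : nat_iso F G) (x : F a) :
  generates x -> generates (s a x).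
Proof.
move=> gx b y; have [f fx] := gx b (ni_inv s b y); exists f.
by rewrite -nt_natural fx ni_invE ni_invKV.
Qed.

End Generators.
End Functors.

(** * Automorphisms and summands of a functor with one generator *)

Section OneGenerator.
Variables (ol : finComNzRingType) (R : finAlgType ol).
Variables (n : nat) (M : 'I_n -> finLmodType R) (a : 'I_n -> nat).
Hypothesis ha : forall i, (1 <= a i)%N.
Local Notation obj := ('I_n -> nat).
Local Notation X b := (dsum M b : finLmodType R).
Local Notation E := (hom (X a) (X a)).
Variables (F : functor M) (m : F a).
Hypothesis gen_m : generates m.

Lemma autF_eq (s t : autF F) : s a m = t a m -> s = t.
Proof.
move=> st; apply: nat_isoP => b x; have [f <-] := gen_m x.
by rewrite !nt_natural st.
Qed.

Lemma autF_lift (s : autF F) : exists u : autR (X a), fmap F (autR_hom u) m = s a m.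
Proof. exact/generators_conj/nat_iso_generates. Qed.

Lemma card_autF_le : (#|[set: autF F]| <= #|[set: autR (X a)]|)%N.
Proof.
have /choice[h hP] := autF_lift; rewrite !cardsT; apply: (@leq_card _ _ h) => s t st.
by apply: autF_eq; rewrite -!hP st.
Qed.

Section EqualCard.
Hypothesis eq_card : #|[set: autR (X a)]| = #|[set: autF F]|.

(** Choosing a lift of each automorphism of [F] is injective, hence bijective when
    the groups have the same order: every automorphism of [X a] is the chosen lift
    of an automorphism of [F], which therefore has no other lift. *)
Lemma autR_descends (u : autR (X a)) :
  exists s : autF F, fmap F (autR_hom u) m = s a m.
Proof.
have /choice[h hP] := autF_lift.
have hI : injective h by move=> s t st; apply: autF_eq; rewrite -!hP st.
have [|h' _ hK] := inj_card_bij hI; first by rewrite -!cardsT eq_card.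
by exists (h' u); rewrite -hP hK.
Qed.

Lemma autR_stab1 (u : autR (X a)) : fmap F (autR_hom u) m = m -> u = 1%g.
Proof.
have /choice[h hP] := autF_lift.
have hI : injective h by move=> s t st; apply: autF_eq; rewrite -!hP st.
have [|h' _ hK] := inj_card_bij hI; first by rewrite -!cardsT eq_card.
move=> um; rewrite -[u]hK -[1%g]hK; congr h; apply: autF_eq.
by rewrite -!hP !hK um autR_hom1 fmap_idE.
Qed.

(** The results on ideals with few unipotents apply to the annihilator of [m]:
    when [f] annihilates [m], [1 + f] fixes [m]; and when [s] is the lift of [t],
    [f s m = f (t m) = t (f m) = 0]. *)
Lemma annihilator_idem : exists e : E,
  [/\ fmap F e m = 0, e * e = e, forall x, e * x = x * e
    & forall f : E, fmap F f m = 0 -> f * e = f].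
Proof.
pose N (f : E) := fmap F f m = 0.
have NB x y : N x -> N y -> N (x - y) by rewrite /N fmapB => -> ->; rewrite subrr.
have NM z x : N x -> N (z * x) by rewrite /N mulhomE fmap_compE => ->; rewrite linear0.
have Nuni x y : N x -> y * (1 + x) = 1 -> x = 0.
  move=> Nx /linv_autR[u ux]; have : u = 1%g.
    by apply: autR_stab1; rewrite ux fmapD Nx onehomE fmap_idE addr0.
  move=> u1; apply: (@addrI _ (1 : E)); rewrite -ux u1 autR_hom1 addr0.
  by rewrite onehomE.
have Nunit x u v : N x -> v * u = 1 -> N (x * u).
  move=> Nx /linv_autR[s <-]; have [t st] := autR_descends s.
  by rewrite /N mulhomE fmap_compE st -nt_natural Nx linear0.
have [|e [Ne ee Nf]] := ideal_gen_idem NB NM Nuni Nunit; first exact: fmap0.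
by exists e; split=> // x; apply: (ideal_idem_central NB NM Nuni Nunit).
Qed.
End EqualCard.

Section Faithful.
Hypothesis faith : forall f : E, fmap F f m = 0 -> f = 0.

Lemma generator_inj b (f g : hom (X a) (X b)) :
  fmap F f m = fmap F g m -> f = g.
Proof.
move=> fg; apply/eqP; rewrite -subr_eq0; apply/eqP.
apply: (@fmap_separates _ _ _ M a (yon M a) ha b (f - g)) => h.
rewrite /= mkhomE; apply: faith.
by rewrite fmap_compE fmapB fg subrr linear0.
Qed.

Let coeff b (y : F b) : hom (X a) (X b) := projT1 (cid (gen_m y)).
Let coeffE b (y : F b) : fmap F (coeff y) m = y.
Proof. exact: projT2 (cid (gen_m y)). Qed.

Fact coeff_linear b : linear (@coeff b).
Proof. by move=> k x y; apply: generator_inj; rewrite fmap_linear !coeffE. Qed.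

Fact coeff_natural b c (f : hom (X b) (X c)) (x : F b) :
  mkhom (@coeff_linear c) (fmap F f x)
  = fmap (yon M a) f (mkhom (@coeff_linear b) x).
Proof.
by rewrite /= !mkhomE; apply: generator_inj; rewrite fmap_compE !coeffE.
Qed.

Fact coeff_bij b : bijective (mkhom (@coeff_linear b)).
Proof.
exists (fun f => fmap F f m) => [y|f]; rewrite mkhomE ?coeffE //.
by apply: generator_inj; rewrite coeffE.
Qed.

(** By Yoneda's lemma [m] corresponds to the transformation [f |-> f m] from
    [yon M a] to [F], which is onto because [m] generates and one-to-one because
    its annihilator vanishes; the isomorphism sought is its inverse. *)
Lemma represented : exists s : nat_iso F (yon M a), s a m = idhom (X a).
Proof.
pose s := @NatTrans _ _ _ _ F (yon M a) (fun b => mkhom (@coeff_linear b)) coeff_natural.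
exists (@NatIso _ _ _ _ F (yon M a) s coeff_bij).
by rewrite /= mkhomE; apply: generator_inj; rewrite coeffE fmap_idE.
Qed.
End Faithful.

Section RightMultiplication.
Hypothesis ann_stable : forall x f : E, fmap F f m = 0 -> fmap F (f * x) m = 0.

(** When the annihilator of [m] is stable under right multiplication, [E] acts on
    [F] from the right by [f m |-> f x m]. *)
Lemma rmul_wd b (x : E) (f g : hom (X a) (X b)) :
  fmap F f m = fmap F g m -> fmap F (comphom f x) m = fmap F (comphom g x) m.
Proof.
move=> fg; apply/eqP; rewrite -subr_eq0 -fmapB; apply/eqP.
apply: (fmap_separates ha) => h; rewrite -fmap_compE.
have -> : comphom h (comphom f x - comphom g x) = comphom h (f - g) * x.
  by apply/homP => y; rewrite !(comphomE, hom_addE, hom_oppE).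
by apply: ann_stable; rewrite fmap_compE fmapB fg subrr linear0.
Qed.

Variable x : E.
Let rfun b (y : F b) : F b := fmap F (comphom (projT1 (cid (gen_m y))) x) m.

Let rfunE b (f : hom (X a) (X b)) : rfun (fmap F f m) = fmap F (comphom f x) m.
Proof. by apply: rmul_wd; case: cid. Qed.

Fact rfun_linear b : linear (@rfun b).
Proof.
move=> k y z; have [f <-] := gen_m y; have [g <-] := gen_m z.
rewrite -fmap_linear !rfunE -fmap_linear; congr (fmap F _ m).
by apply/homP => w; rewrite !(comphomE, hom_addE, hom_scaleE).
Qed.

Fact rfun_natural b c (f : hom (X b) (X c)) (y : F b) :
  mkhom (@rfun_linear c) (fmap F f y) = fmap F f (mkhom (@rfun_linear b) y).
Proof.
rewrite !mkhomE; have [g <-] := gen_m y.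
by rewrite -fmap_compE !rfunE -comphomA fmap_compE.
Qed.

Definition rmul : nat_trans F F := NatTrans rfun_natural.

Lemma rmulE b (f : hom (X a) (X b)) : rmul b (fmap F f m) = fmap F (comphom f x) m.
Proof. by rewrite /= mkhomE rfunE. Qed.
End RightMultiplication.

Section CentralAnnihilator.
Hypothesis indecM : forall i, mod_indec (M i).
Variable e : E.
Hypothesis em : fmap F e m = 0.
Hypothesis ee : e * e = e.
Hypothesis eC : forall x, e * x = x * e.
Hypothesis ann_e : forall f : E, fmap F f m = 0 -> f * e = f.

Let ann_stable x f : fmap F f m = 0 -> fmap F (f * x) m = 0.
Proof.
by move/ann_e <-; rewrite -mulrA eC mulrA mulhomE fmap_compE em linear0.
Qed.
Local Notation rmul := (rmul ann_stable).

Lemma retractE (A : functor M) (s : nat_trans A F) (r : nat_trans F A) (c : E) b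
    (h : hom (X a) (X b)) : s a (r a m) = fmap F c m ->
  s b (r b (fmap F h m)) = fmap F (comphom h c) m.
Proof. by move=> src; rewrite !nt_natural src fmap_compE. Qed.

(** The summands of [F] are cut out by idempotents of [E]; those of type [j] by
    idempotents whose image is isomorphic to [M j]. *)
Definition summand_type (A : functor M) (j : 'I_n) : Prop :=
  exists (s : nat_trans A F) (r : nat_trans F A) (f : hom (X a) (M j)) (g : hom (M j) (X a)),
  [/\ forall b x, r b (s b x) = x, s a (r a m) = fmap F (comphom g f) m,
      comphom f g = idhom (M j) & comphom g f * e = 0].

Lemma summand_type_iso A B j : summand_type A j -> summand_type B j ->
  functor_iso A B.
Proof.
have cross A' B' (s1 : nat_trans A' F) (r1 : nat_trans F A')
    (s2 : nat_trans B' F) (r2 : nat_trans F B')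
    (f1 f2 : hom (X a) (M j)) (g1 g2 : hom (M j) (X a)) :
    (forall b x, r1 b (s1 b x) = x) -> s1 a (r1 a m) = fmap F (comphom g1 f1) m ->
    s2 a (r2 a m) = fmap F (comphom g2 f2) m -> comphom f2 g2 = idhom (M j) ->
    forall b z, nt_comp r1 (nt_comp (rmul (comphom g2 f1)) s2) b
      (nt_comp r2 (nt_comp (rmul (comphom g1 f2)) s1) b z) = z.
  move=> rs1 sr1 sr2 fg2 b z; have [h hz] := gen_m (s1 b z).
  rewrite !nt_compE -hz rmulE (retractE _ sr2) rmulE.
  have -> : comphom (comphom (comphom h (comphom g1 f2)) (comphom g2 f2)) (comphom g2 f1)
      = comphom h (comphom g1 f1).
    by rewrite -!comphomA !(comphomA f2 g2) fg2 !comp1hom.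
  by rewrite -(retractE _ sr1) hz !rs1.
move=> [s [r [f [g [rs src fg _]]]]] [s' [r' [f' [g' [rs' src' fg' _]]]]].
pose p := nt_comp r' (nt_comp (rmul (comphom g f')) s).
suff pb b : bijective (p b) by constructor; exact: (@NatIso _ _ _ _ A B p pb).
exists (nt_comp r (nt_comp (rmul (comphom g' f)) s') b); first exact: cross.
exact: cross.
Qed.

(** The projection onto a summand [A] of [F] maps [m] to [c m] for a unique [c] in
    [E] with [c e = 0].  An idempotent [x] below [c] acts on [A] through [rmul], so
    indecomposability of [A] makes [c] primitive. *)
Lemma indec_summand_type A B : functor_indec A -> functor_dsum F A B ->
  exists j, summand_type A j.
Proof.
move=> indA /functor_dsum_retract[s [r rs]].
have faith (f g : E) : f * e = g * e -> fmap F f m = fmap F g m -> f = g.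
  move=> fge fgm; apply/eqP; rewrite -subr_eq0; apply/eqP.
  by rewrite -[f - g]ann_e ?fmapB ?fgm ?subrr // mulrBl fge subrr.
have [c [src ce]] : exists c : E, s a (r a m) = fmap F c m /\ c * e = 0.
  have [c cm] := gen_m (s a (r a m)); exists (c - c * e).
  by rewrite -cm fmapB mulrBl -mulrA ee subrr mulhomE fmap_compE em linear0 subr0.
have cc : c * c = c.
  apply: faith; first by rewrite -mulrA ce mulr0.
  by rewrite mulhomE -(retractE _ src) -src rs.
have prim_c : primitive c.
  split=> // [|x cxc xx].
    apply/eqP => c0; case: indA => A0 _; case: A0 => b z.
    have [h hz] := gen_m (s b z); rewrite -[z]rs -{1}[z]rs.
    by rewrite -hz (retractE _ src) c0 comphom0 fmap0 linear0.
  have xc : x * c = x by rewrite -cxc -mulrA cc.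
  have cx : c * x = x by rewrite -cxc !mulrA cc.
  have xe : x * e = 0 by rewrite -xc -mulrA ce mulr0.
  have rr b z : nt_comp r (nt_comp (rmul x) s) b (nt_comp r (nt_comp (rmul x) s) b z)
      = nt_comp r (nt_comp (rmul x) s) b z.
    have [h hz] := gen_m (s b z).
    rewrite !nt_compE -hz rmulE (retractE _ src) rmulE; congr (r b (fmap F _ m)).
    by rewrite -!(comphomA h) -!mulhomE xc xx.
  have rxm : s a (nt_comp r (nt_comp (rmul x) s) a (r a m)) = fmap F x m.
    rewrite !nt_compE src rmulE (retractE _ src) -!mulhomE.
    by rewrite -mulrA xc cx.
  case: (functor_indec_idem indA rr) => px; [left|right]; apply: faith.
  - by rewrite xe mul0r.
  - by rewrite -rxm px linear0 fmap0.
  - by rewrite xe ce.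
  - by rewrite -rxm px src.
have [j [f [g [gf fg]]]] := primitive_split indecM prim_c.
by exists j, s, r, f, g; split=> //; rewrite gf.
Qed.

(** If [e] is not zero, then some projection of [X a] to a summand [M (tag k)] lies
    below [e].  For a map [f] to this summand, [(dinj k) f = e (dinj k) f = (dinj k) f e]
    because [e] is central; so [f] vanishes as soon as [f e] does. *)
Lemma missing_type : e != 0 -> exists i, forall A, ~ summand_type A i.
Proof.
move=> e0; pose E_ k : E := comphom (dinj M k) (dproj M k).
have [k ek] : exists k, e * E_ k != 0.
  apply/existsP; apply: contraNT e0 => /existsPn ek0.
  rewrite -[e]mulr1 onehomE -sum_dinj_dproj mulr_sumr big1 // => k _.
  exact/eqP/negbNE/ek0.
have EE : E_ k * E_ k = E_ k.
  by rewrite mulhomE /E_ -comphomA (comphomA _ (dinj M k)) dinjK comp1hom.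
pose d := comphom (comphom (dproj M k) e) (dinj M k).
have Ed : e * E_ k = comphom (comphom (dinj M k) d) (dproj M k).
  have -> : e * E_ k = E_ k * e * E_ k by rewrite -eC -mulrA EE.
  by rewrite !mulhomE /d /E_ !comphomA.
have dd : d * d = d.
  have -> : d * d = comphom (comphom (dproj M k) (e * E_ k * e)) (dinj M k).
    by rewrite !mulhomE /d /E_ !comphomA.
  by rewrite -(mulrA e) -eC mulrA ee mulhomE /E_ /d -!comphomA dinjK comphom1.
have eE : e * E_ k = E_ k.
  case: (indec_idem (indecM (tag k)) dd) => d1; rewrite Ed d1.
    by case/eqP: ek; rewrite Ed d1 comphom0 comp0hom.
  by rewrite onehomE comphom1.
exists (tag k) => A [_ [_ [f [g [_ _ fg gfe]]]]].
pose w : E := comphom (dinj M k) f.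
have w0 : w = 0.
  have ew : e * w = w.
    have -> : w = E_ k * w.
      by rewrite mulhomE /E_ /w -comphomA (comphomA _ (dinj M k)) dinjK comp1hom.
    by rewrite mulrA eE.
  rewrite -ew eC; have -> : w = comphom (dinj M k) (comphom f (comphom g f)).
    by rewrite (comphomA f) fg comp1hom.
  by rewrite mulhomE -!comphomA (comphomA g) -mulhomE gfe !comphom0.
have f0 : f = 0.
  by rewrite -[f]comp1hom -(dinjK M k) -comphomA -/w w0 comphom0.
have [Mk _] := indecM (tag k); apply: Mk => x.
by rewrite -[x]idhomE -fg f0 comp0hom hom_0E.
Qed.

Lemma suppF_le : (suppF F <= n)%N.
Proof.
rewrite -[Y in (_ <= Y)%N]card_ord -cardsT.
apply: (@class_count_le _ _ _ _ _ summand_type) => [A [indA [B dA]]|A B j _ _].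
  by have [j Aj] := indec_summand_type indA dA; exists j; rewrite ?inE.
exact: summand_type_iso.
Qed.

Lemma suppF_lt : e != 0 -> (suppF F < n)%N.
Proof.
case/missing_type=> i no_i.
have lt_n : (#|[set~ i]| < n)%N.
  by rewrite cardsC1 card_ord ltn_predL; apply: leq_ltn_trans (ltn_ord i).
apply: leq_ltn_trans lt_n.
apply: (@class_count_le _ _ _ _ _ summand_type) => [A [indA [B dA]]|A B j _ _].
  have [j Aj] := indec_summand_type indA dA; exists j => //.
  by rewrite !inE; apply/eqP => ji; apply: (no_i A); rewrite -ji.
exact: summand_type_iso.
Qed.
End CentralAnnihilator.

End OneGenerator.

(** * Intertwiners from the permutation representations [KF] *)

Section PermutationIntertwiners.
Variables (K : fieldType) (ol : finComNzRingType) (R : finAlgType ol).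
Variables (n : nat) (M : 'I_n -> finLmodType R) (a : 'I_n -> nat).
Local Notation X := (dsum M a : finLmodType R).
Variables (d : nat) (V : mx_representation K [set: autR X] d).
Variable F : functor M.
Local Notation u x := (delta_mx 0 (enum_rank x) : 'rV[K]_#|F a|).

Lemma KF_u x s : u x *m KF K a F s = u (fmap F (autR_hom s) x).
Proof. exact: act_mxE. Qed.

Lemma KF_autF_u x t : u x *m KF_autF K a F t = u (t a x).
Proof. exact: act_mxE. Qed.

Lemma u_neq0 d' (h : 'M[K]_(#|F a|, d')) : h != 0 -> exists x, u x *m h != 0.
Proof.
move=> h0; suff /existsP[i hi] : [exists i, row i h != 0].
  by exists (enum_val i); rewrite enum_valK -rowE.
apply: contraNT h0 => /existsPn h0; apply/eqP/row_matrixP => i.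
by rewrite row0; apply/eqP/negPn/h0.
Qed.

Hypothesis V_prec : forall G, prec G F -> hom_mx (KF K a G) V = 0.

(** Otherwise the subfunctor generated by [x] would be below [F], and [h] would
    restrict to a nonzero intertwiner on it. *)
Lemma intertwiner_generates (h : 'M[K]_(#|F a|, d)) x :
    (forall s, KF K a F s *m h = h *m V s) -> u x *m h != 0 ->
  generates x.
Proof.
move=> hC; have [//|ngen] := generates_or_prec x; case/eqP.
pose i := subfunctor_incl (gen_submod x) (gen_stable (x := x)).
pose P : 'M[K]_(#|generated x a|, #|F a|) := \matrix_k u (i a (enum_val k)).
have PE (y : generated x a) : delta_mx 0 (enum_rank y) *m P = u (i a y).
  by rewrite -rowE rowK enum_rankK.
have [y <-] := mem_generated x; rewrite -PE -mulmxA.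
have -> : P *m h = 0; last exact: mulmx0.
have /hom_mx0P := V_prec ngen; apply=> s _.
rewrite -mulmxA -hC !mulmxA; congr (_ *m h).
apply/row_matrixP => k; rewrite !rowE -(enum_valK k) !mulmxA PE KF_u -nt_natural.
by rewrite -PE; congr (_ *m P); apply: act_mxE.
Qed.

Lemma exists_generator : hom_mx (KF K a F) V != 0 -> exists m : F a, generates m.
Proof.
move=> V0; have [h hC h0] : exists2 h, (forall s, KF K a F s *m h = h *m V s) & h != 0.
  apply: contrapT => nh; case/eqP: V0; apply/hom_mx0P => h hC.
  by apply: contrapT => /eqP h0; apply: nh; exists h => // s; apply: hC; rewrite inE.
have [x hx] := u_neq0 h0; exists x; exact: (intertwiner_generates hC hx).
Qed.

(** Generators form one orbit of [autR X], and all other basis vectors are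
    sent to 0. *)
Lemma intertwiner_eq0 (h : 'M[K]_(#|F a|, d)) (m : F a) :
    generates m -> (forall s, KF K a F s *m h = h *m V s) -> u m *m h = 0 -> h = 0.
Proof.
move=> gm hC hm; apply: contrapT => /eqP/u_neq0[x hx].
have [s ux] := generators_conj gm (intertwiner_generates hC hx).
by move: hx; rewrite -ux -KF_u -mulmxA hC mulmxA hm mul0mx eqxx.
Qed.

Hypothesis char0 : [pchar K] =i pred0.

Section Bar.
Variables (U : 'M[K]_#|F a|) (barU : KFbar U).
Let rU := submod_repr (KFbar_module barU).
Let sU := submod_repr (KFbar_autF_module barU).
Let J : 'M_(\rank U, #|F a|) := val_submod 1%:M.

Lemma Maschke (W : 'M[K]_#|F a|) : mxmodule (KF K a F) W -> exists W' : 'M[K]_#|F a|,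
  [/\ mxmodule (KF K a F) W', (W + W' :=: 1%:M)%MS & (W :&: W')%MS = 0].
Proof.
move=> modW; have [||W' modW' sumW dxW] := @mx_Maschke_pchar _ _ _ _ (KF K a F) _ W modW.
- apply/pgroup.pgroupP => p _ _; rewrite inE /=.
  by have := char0 p; rewrite !inE => ->.
- exact: submx1.
by exists W'; split=> //; apply/mxdirect_addsP.
Qed.

(** A complement [W] of the kernel of [g] embeds in [V], hence receives no
    intertwiner from [KF G] for [G] below [F], and lies in the bar part. *)
Lemma bar_separates (g : 'M[K]_(#|F a|, d)) :
  (forall s, KF K a F s *m g = g *m V s) -> J *m g = 0 -> g = 0.
Proof.
move=> gC Jg.
have modk : mxmodule (KF K a F) (kermx g).
  by apply/mxmoduleP => s _; rewrite sub_kermx -mulmxA gC mulmxA mulmx_ker mul0mx.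
have [W [modW sumW dxW]] := Maschke modk.
have WU : (W <= U)%MS.
  case: (barU) => _; apply; apply/hom_freeP; split=> // G GF k kC kW.
  have kg : k *m g = 0.
    have /hom_mx0P := V_prec GF; apply=> s _.
    by rewrite mulmxA kC -!mulmxA gC.
  by apply/eqP; rewrite -submx0 -dxW sub_capmx kW sub_kermx kg eqxx.
have Wg : (W <= kermx g)%MS.
  rewrite sub_kermx; apply/eqP; have: (W <= J)%MS by rewrite val_submod1.
  by case/submxP=> C ->; rewrite -mulmxA Jg mulmx0.
apply/eqP; rewrite -[g]mul1mx -sub_kermx -sumW.
by rewrite addsmx_sub submx_refl Wg.
Qed.

(** Maschke's theorem again: the projection along an invariant complement. *)
Lemma bar_retraction : exists Q : 'M_(#|F a|, \rank U),
  (forall s, KF K a F s *m Q = Q *m rU s) /\ J *m Q = 1%:M.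
Proof.
have [W [modW sumW dxW]] := Maschke (KFbar_module barU).
pose P := proj_mx U W.
have PU : (P <= U)%MS by rewrite -[P]mul1mx proj_mx_sub.
have idP m' (Y : 'M_(m', _)) : (Y <= U)%MS -> Y *m P = Y := proj_mx_id dxW.
have zP m' (Y : 'M_(m', _)) : (Y <= W)%MS -> Y *m P = 0 := proj_mx_0 dxW.
have PC s : KF K a F s *m P = P *m KF K a F s.
  have one : (1%:M : 'M[K]_#|F a|) = P + proj_mx W U.
    have := @add_proj_mx _ _ _ U W 1%:M dxW; rewrite !mul1mx => -> //.
    by rewrite sumW.
  rewrite -[LHS]mul1mx [in LHS]one mulmxDl !(mulmxA _ (KF K a F s) P) idP ?zP ?addr0 //.
    rewrite (submx_trans _ (mxmoduleP modW s (in_setT s))) // submxMr //.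
    by rewrite -[Y in (Y <= _)%MS]mul1mx proj_mx_sub.
  by rewrite (submx_trans _ (mxmoduleP (KFbar_module barU) s (in_setT s))) ?submxMr.
exists (in_submod U P); split=> [s|].
  by rewrite -in_submodJ // -PC [LHS]mulmxA.
have -> : J *m in_submod U P = in_submod U (J *m P).
  by rewrite [RHS]in_submodE [in LHS]in_submodE mulmxA.
by rewrite idP ?val_submod1 // val_submodK.
Qed.

(** Evaluation at the basis vector of a generator [m] embeds [Hom(U, V)] into [V].
    If an automorphism [t] of [F] and an automorphism [s] of [X] satisfy
    [t^-1 m = s m], then [(h \o t^-1) (u m) = h (s (u m)) = s (h (u m))].
    An intertwiner [h] defined on [U] only is first extended by the projection
    of [bar_retraction]; by [bar_separates] the extension is unique, hence
    compatible with [t]. *)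
Lemma evaluation m : generates m ->
  exists2 B : 'M_(\rank (hom_mx rU V), d), row_free B &
    forall s (t : autF F), (t^-1)%g a m = fmap F (autR_hom s) m ->
      tilde_repr barU V t *m B = B *m V s.
Proof.
move=> gm; have [Q [QC JQ]] := bar_retraction.
pose W := hom_mx rU V; pose L := lin_mul_row (u m *m Q) : 'M_(\rank U * d, d).
have extC (h : 'M_(\rank U, d)) : (mxvec h <= W)%MS ->
    forall s, KF K a F s *m (Q *m h) = Q *m h *m V s.
  by move=> /hom_mxP hC s; rewrite mulmxA QC -(mulmxA Q (rU s)) hC ?inE // mulmxA.
have injL : (W :&: kermx L = 0)%MS.
  apply/eqP/rowV0P => v; rewrite sub_capmx sub_kermx -[v]vec_mxK.
  set h := vec_mx v => /andP[hW]; rewrite mul_vec_lin_row -mulmxA => /eqP hm.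
  have Qh := intertwiner_eq0 gm (extC h hW) hm.
  by rewrite -[h]mul1mx -JQ -mulmxA Qh mulmx0 linear0.
pose B : 'M_(\rank W, d) := val_submod 1%:M *m L.
exists B => [|s t ts].
  rewrite /row_free; have -> : \rank B = \rank (val_submod (1%:M : 'M_(\rank W))).
    apply/mxrank_injP; rewrite -submx0 -injL; apply: capmxS => //.
    by rewrite val_submod1.
  by rewrite val_submod1.
have -> : tilde_repr barU V t *m B = val_submod 1%:M *m precomp_mx d sU t *m L.
  rewrite /B mulmxA; congr (_ *m L).
  have := val_submodJ (hom_precomp_module barU V) 1%:M (in_setT t).
  by rewrite mul1mx [in LHS]val_submodE.
rewrite /B; move: (val_submod _) (val_submod1 W) => C CW.
apply/row_matrixP => i; rewrite !row_mul.
set v := row i _; have vW : (v <= W)%MS.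
  by rewrite (submx_trans (row_sub _ _)) // CW.
move: vW; rewrite -[v]vec_mxK; set h := vec_mx v => hW.
rewrite mul_vec_lin !mul_vec_lin_row -[LHS]/(u m *m Q *m (sU t^-1%g *m h)).
have Jt : J *m KF_autF K a F t^-1%g = sU t^-1%g *m J.
  have := val_submodJ (KFbar_autF_module barU) 1%:M (in_setT t^-1%g).
  by rewrite mul1mx [in LHS]val_submodE => ->.
(* Both sides are intertwiners that restrict to [sU t^-1 *m h] on [U]. *)
have ext_t : Q *m (sU t^-1%g *m h) = KF_autF K a F t^-1%g *m (Q *m h).
  apply/eqP; rewrite -subr_eq0; apply/eqP/bar_separates => [s'|].
    rewrite mulmxBr mulmxBl; congr (_ - _); last first.
      by rewrite !mulmxA KF_comm -!mulmxA; congr (_ *m _); rewrite !mulmxA -extC ?mulmxA.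
    apply: extC; have := submx_trans (submxMr (precomp_mx d sU t) hW)
      (mxmoduleP (hom_precomp_module barU V) t (in_setT t)).
    by rewrite mul_vec_lin.
  by rewrite mulmxBr !(mulmxA J) JQ mul1mx Jt -(mulmxA _ J) (mulmxA J) JQ mul1mx subrr.
rewrite -(mulmxA (u m) Q) ext_t (mulmxA (u m)) KF_autF_u ts.
by rewrite -KF_u -(mulmxA (u m)) extC // !mulmxA.
Qed.
End Bar.
End PermutationIntertwiners.

(** * Comparison of degrees *)

Lemma le_degree (x1 x2 x3 y1 y2 y3 : nat) :
  (x1 <= y1)%N -> (y1 = x1 -> (x2 <= y2)%N) ->
  (y1 = x1 -> y2 = x2 -> (x3 <= y3)%N) ->
  (((x1, (x2, x3)) : degree) <= (y1, (y2, y3)))%O.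
Proof.
move=> le1 le2 le3; rewrite leEprodlexi /= !leEnat le1 /=; apply/implyP => ge1.
have e1 : y1 = x1 by apply/eqP; rewrite eqn_leq ge1.
rewrite leEprodlexi /= !leEnat le2 //=; apply/implyP => ge2.
by apply: le3 => //; apply/eqP; rewrite eqn_leq ge2 le2.
Qed.

Theorem theorem3
  (o : idomainType) (pi : o)
  (ho : dvr_with_uniformiser pi) (hc : adically_complete pi)
  (hk : finite_residue_field pi)
  (l : nat) (hl : (1 <= l)%N)
  (ol : finComNzRingType) (q : {rmorphism o -> ol})
  (hq : quotient_map (pi ^+ l) q)
  (R : finAlgType ol)
  (K : closedFieldType) (hK : [pchar K] =i pred0)
  (n : nat) (M : 'I_n -> finLmodType R)
  (hindec : forall i, mod_indec (M i))
  (hniso : forall i j, i != j -> ~ mod_iso (M i) (M j))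
  (a : 'I_n -> nat) (ha : forall i, (1 <= a i)%N)
  (d : nat) (V : mx_representation K [set: autR (dsum M a)] d)
  (hV : mx_irreducible V)
  (F : functor M) (e : nat) (Vt : mx_representation K [set: autF F] e)
  (hF : functor_morphing V Vt) :
  (degF Vt <= degM V)%O /\
  (degM V = degF Vt ->
   exists f : nat_iso F (yon M a),
     mx_rsim V (pullback_repr (yon_transportM f) Vt)).
Proof.
have [VF VG [U [barU sim]]] := hF.
have [m gm] := exists_generator VG VF.
have [B freeB eqB] := evaluation VG hK barU gm.
have [B0 eB0 freeB0 eqB0] := sim.
have dim_le : (e <= d)%N.
  by rewrite eB0 -(eqP freeB) rank_leq_col.
have supp_le := suppM_ge hindec hniso ha.
split.
  apply: le_degree => // [_|_ eq_card]; first exact: card_autF_le gm.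
  have [e0 [e0m ee eC ann]] := annihilator_idem gm eq_card.
  exact: leq_trans (suppF_le ha gm hindec e0m ee eC ann) supp_le.
case=> ed eq_card eq_supp.
have [e0 [e0m ee eC ann]] := annihilator_idem gm eq_card.
have e00 : e0 = 0.
  apply/eqP/negPn/negP => /(suppF_lt ha gm hindec e0m ee eC ann).
  by rewrite -eq_supp ltnNge supp_le.
have [f fm] : exists f : nat_iso F (yon M a), f a m = idhom (dsum M a).
  by apply: (represented ha gm) => f /ann <-; rewrite e00 mulr0.
exists f; apply: mx_rsim_sym.
apply: (@MxReprSim _ _ _ _ _ _ _ (B0 *m B)) => //.
  by rewrite /row_free mxrankMfree.
move=> s _ /=; set t := yon_transport f s.
(* [f] sends [m] to the identity, so [s m] to [s], and precomposition with [s^-1]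
   turns [s] back into the identity. *)
have tx : t a (fmap F (autR_hom s) m) = m.
  rewrite /t /yon_transport /conj_aut !(ni_compE, ni_invE) nt_natural fm -[RHS](ni_invK f).
  congr (ni_inv_fun f _); rewrite fm; apply/homP => y.
  by rewrite yon_autE /= mkhomE comphomE !idhomE mkhomE /= permKV.
have tm : (t^-1)%g a m = fmap F (autR_hom s) m.
  rewrite -{1}tx -[LHS](ni_compE t t^-1%g) -[ni_comp _ _]/(t * t^-1)%g mulgV.
  exact: idhomE.
by rewrite mulmxA eqB0 ?inE // -(mulmxA B0 (tilde_repr _ _ t)) (eqB s t tm) mulmxA.
Qed.
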